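(* The increasing functions $w_1,w_0:(0,\infty)\to\mathbb R$ defined by $$w_1(x)=R_h(x),\qquad w_0(x)=R_h(x)-K_1,\qquad x>0,$$ satisfy the HJB equation (stated in the context) if and only if $$\max\{rK_1,\ rK_1-rK\}\le h(0).$$
   Context: Let $b\in\mathbb R$, $\sigma\ne0$, $r>0$ be constants, $W$ a standard one-dimensional Brownian motion and, for $x>0$, let $X$ solve $dX_t=bX_t\,dt+\sqrt2\,\sigma X_t\,dW_t$, $X_0=x$. Standing assumption: $h:(0,\infty)\to\mathbb R$ is right-continuous and increasing (not necessarily strictly), $\lim_{x\to\infty}h(x)=\infty$, $\mathbb E[\int_0^\infty e^{-rt}|h(X_t)|\,dt]<\infty$ for every $x>0$; $K_1,K_0>0$, $K\in\mathbb R$. Put $h(0):=\lim_{x\downarrow0}h(x)$. The constants $m<0<n$ are $m,n=\frac1{2\sigma^2}\big[\sigma^2-b\mp\sqrt{(b-\sigma^2)^2+4\sigma^2r}\big]$, and $$R_h(x)=\frac1{\sigma^2(n-m)}\Big[x^m\int_0^xs^{-m-1}h(s)\,ds+x^n\int_x^\infty s^{-n-1}h(s)\,ds\Big]=\mathbb E\Big[\int_0^\infty e^{-rs}h(X_s)\,ds\Big].$$ HJB equation: the coupled quasi-variational inequalities $$\max\{\sigma^2x^2w_1''(x)+bxw_1'(x)-rw_1(x)+h(x),\ w_0(x)-w_1(x)-K_0,\ -w_1(x)-K\}=0,$$ $$\max\{\sigma^2x^2w_0''(x)+bxw_0'(x)-rw_0(x),\ w_1(x)-w_0(x)-K_1,\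 -w_0(x)-K\}=0$$ on $(0,\infty)$; the solutions $w_1,w_0$ are $C^1$ as well as $C^2$ outside a finite set, and satisfy these equations in the classical sense.
   Formalization: ''C^2 outside a finite set'' is read as C^2, with the equations holding, outside a finite set together with the discontinuities of h; taken literally the ''if'' part fails when h has infinitely many jumps, e.g. h = c + floor(x), since R_h'' jumps wherever h does. *)

(* Defs.v *)
From HB Require Import structures.
From mathcomp Require Import all_boot all_order all_algebra.
From mathcomp Require Import all_classical all_reals all_analysis.
Export Order.TTheory GRing.Theory Num.Theory.
Export numFieldNormedType.Exports.

Set Implicit Arguments.
Unset Strict Implicit.
Unset Printing Implicit Defensive.

#[global] Open Scope classical_set_scope.
#[global] Open Scope ring_scope.

(* Functions of x in (0,oo) are total functions R -> R of which only the values
   at positive arguments are ever constrained; similarly, processes are indexed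
   by R and only times t >= 0 matter. *)

Section Probability.
Context {R : realType} {d : measure_display} {T : measurableType d}.
Implicit Types (P : probability T R) (F : R -> set (set T)).
Implicit Types (W X Y : R -> T -> R).

Record is_filtration F : Prop := IsFiltration {
  filtration_sigma_algebra : forall t : R, 0 <= t -> sigma_algebra setT (F t) ;
  filtration_measurable : forall t : R, 0 <= t -> F t `<=` measurable ;
  filtration_nondecreasing : forall s t : R, 0 <= s -> s <= t -> F s `<=` F t }.

Definition adapted F X : Prop :=
  forall t : R, 0 <= t -> forall B : set R, measurable B -> F t (X t @^-1` B).

Definition continuous_paths X : Prop :=
  forall w, {within `[0, +oo[, continuous (fun t : R => X t w)}.

(* The second argument of [normal_prob] is the standard deviation. *)
Record is_brownian_motion P F W : Prop := IsBrownianMotion {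
  brownian_start : forall w, W 0 w = 0 ;
  brownian_continuous : continuous_paths W ;
  brownian_adapted : adapted F W ;
  brownian_gaussian : forall s t : R, 0 <= s -> s < t ->
    forall B : set R, measurable B ->
      P ((fun w => W t w - W s w) @^-1` B) = normal_prob 0 (Num.sqrt (t - s)) B ;
  brownian_independent : forall s t : R, 0 <= s -> s < t ->
    forall (A : set T) (B : set R), F s A -> measurable B ->
      P (A `&` ((fun w => W t w - W s w) @^-1` B)) =
      (P A * P ((fun w => (W t w - W s w)%R) @^-1` B))%E }.

Definition ito_sum Y W (t : R) (N : nat) (w : T) : R :=
  let grid (k : nat) : R := k%:R * t / N%:R in
  \sum_(k < N) Y (grid k) w * (W (grid k.+1) w - W (grid k) w).

(* [I] is the Ito integral of [Y] against [W] over [0,t]: the limit in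
   probability of the left-endpoint sums over the partitions of [0,t] into N
   equal pieces. This is used only for continuous adapted integrands, for which
   the limit exists and is the Ito integral (up to a.s. equality). *)
Definition is_ito_integral P Y W (t : R) (I : T -> R) : Prop :=
  forall eps : R, 0 < eps ->
    P [set w | eps <= `| ito_sum Y W t N w - I w |] @[N --> \oo] --> 0%E.

(* dX_t = b X_t dt + sqrt 2 * sigma X_t dW_t, X_0 = x, in integrated form.
   The state space is (0,oo), on which the running payoff is defined. *)
Record solves_sde P F W (b sigma x : R) X : Prop := SolvesSde {
  sde_start : forall w, X 0 w = x ;
  sde_positive : forall (t : R) (w : T), 0 <= t -> 0 < X t w ;
  sde_continuous : continuous_paths X ;
  sde_adapted : adapted F X ;
  sde_dynamics : forall t : R, 0 <= t ->
    is_ito_integral P (fun s w => Num.sqrt 2 * sigma * X s w) W t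
      (fun w => X t w - x - \int[lebesgue_measure]_(s in `[0, t]) (b * X s w)) }.

Definition expected_discounted_abs P (r : R) (h : R -> R) X : \bar R :=
  (\int[P]_w \int[lebesgue_measure]_(t in `[0%R, +oo[)
     (expR (- r * t) * `|h (X t w)|)%:E)%E.

End Probability.

Section Data.
Context {R : realType}.
Implicit Types (h w : R -> R).

Definition right_continuous_pos h : Prop :=
  forall x : R, 0 < x -> h y @[y --> x^'+] --> h x.

Definition increasing_pos h : Prop :=
  forall x y : R, 0 < x -> x <= y -> h x <= h y.

(* h(0), the limit at 0 from the right; it may be -oo. *)
Definition h_zero h : \bar R := lim ((h x)%:E @[x --> 0^'+]).

Definition exponent_m (b sigma r : R) : R :=
  (sigma ^+ 2 - b - Num.sqrt ((b - sigma ^+ 2) ^+ 2 + 4 * sigma ^+ 2 * r))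
  / (2 * sigma ^+ 2).

Definition exponent_n (b sigma r : R) : R :=
  (sigma ^+ 2 - b + Num.sqrt ((b - sigma ^+ 2) ^+ 2 + 4 * sigma ^+ 2 * r))
  / (2 * sigma ^+ 2).

Definition resolvent (b sigma r : R) h (x : R) : R :=
  let m := exponent_m b sigma r in
  let n := exponent_n b sigma r in
  (sigma ^+ 2 * (n - m))^-1 *
  (x `^ m * \int[lebesgue_measure]_(s in `]0, x[) (s `^ (- m - 1) * h s) +
   x `^ n * \int[lebesgue_measure]_(s in `]x, +oo[) (s `^ (- n - 1) * h s)).

Definition C1_pos w : Prop :=
  forall x : R, 0 < x -> derivable w x 1 /\ {for x, continuous (derive1 w)}.

(* C^2 on (0,oo) outside E. [derive1] is total, so continuity of the second
   derivative is taken within the set of points where it exists. *)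
Definition C2_pos_outside (E : set R) w : Prop :=
  (forall x : R, 0 < x -> ~ E x -> derivable (derive1 w) x 1) /\
  {within [set x | 0 < x] `\` E, continuous (derive1 (derive1 w))}.

Definition jumps h : set R := [set x | 0 < x /\ ~ {for x, continuous h}].

(* Classical solutions (w1, w0), C^1 and C^2 outside a finite set. The second
   derivative of a solution necessarily jumps with h, so the discontinuities of
   h, of which there may be infinitely many, are also excepted; when they are
   finite in number the exceptional set is just a finite set. *)
Definition solves_HJB (b sigma r K1 K0 K : R) h (w1 w0 : R -> R) : Prop :=
  C1_pos w1 /\ C1_pos w0 /\
  exists E : set R, finite_set E /\
    let N := E `|` jumps h in
    C2_pos_outside N w1 /\ C2_pos_outside N w0 /\
    forall x : R, 0 < x -> ~ N x ->
      Num.max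
        (sigma ^+ 2 * x ^+ 2 * derive1 (derive1 w1) x + b * x * derive1 w1 x - r * w1 x + h x)
        (Num.max (w0 x - w1 x - K0) (- w1 x - K)) = 0 /\
      Num.max
        (sigma ^+ 2 * x ^+ 2 * derive1 (derive1 w0) x + b * x * derive1 w0 x - r * w0 x)
        (Num.max (w1 x - w0 x - K1) (- w0 x - K)) = 0.

End Data.

(* Main.v *)
From HB Require Import structures.
Require Import Defs.
From mathcomp Require Import all_boot all_order all_algebra.
From mathcomp Require Import all_classical all_reals all_analysis.
From mathcomp Require Import measurable_realfun ring lra.

(** The assumption on h concerns all solutions X of the stochastic differential
    equation, so it has content only once a solution is exhibited. Geometric
    Brownian motion X_t = x exp ((b - sigma^2) t + sqrt 2 sigma W_t) is one
    ([gbm_solves_sde]): over a grid of step dt the increments of X differ from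
    those of the Ito sum by a drift, whose sum is a Riemann sum, and by a centred
    noise of variance of order dt^2. The noises of successive steps are
    orthogonal, so their sum tends to 0 in second moment.

    For this X the assumption bounds an integral of |h| against the discounted
    occupation density of X. A lower bound of that density by a multiple of
    min (s^(-m-1), s^(-n-1)) ([gbm_occupation_lower_bound]) then makes the two
    integrals in the definition of R_h absolutely convergent
    ([integrable_power_m], [integrable_power_n]).

    From there on the statement is one-dimensional calculus. R_h is C^1 even at
    the jumps of h ([raw_resolvent_derive]); it is nondecreasing, and where h is
    continuous it is twice differentiable and sigma^2 x^2 R'' + b x R' - r R + h = 0
    ([resolvent_ode]). Inserting w1 = R_h and w0 = R_h - K1 into the variational
    inequalities, everything cancels except r K1 <= h and K1 - K <= R_h, which
    have to hold outside a countable set and so, by monotonicity, on (0, oo).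
    Comparison with constant payoffs, and the limit of R_h at 0, show that the
    second one is equivalent to r (K1 - K) <= h on (0, oo) ([resolvent_ge],
    [payoff_ge]). As h is nondecreasing, both together say that h(0) is at least
    the maximum of r K1 and r K1 - r K. *)

Import Order.TTheory GRing.Theory Num.Theory.
Import numFieldNormedType.Exports.
Local Open Scope classical_set_scope.
Local Open Scope ring_scope.

Set Implicit Arguments.
Unset Strict Implicit.
Unset Printing Implicit Defensive.

(** * Measures with a density, and logarithmic substitution *)

Section Density.
Context d (T : measurableType d) (R : realType).
Local Open Scope ereal_scope.

(** The side conditions are arguments so that the measure structure below
    attaches to this constant. *)
Definition density_measure (mu : {measure set T -> \bar R}) (g : T -> R)
    (mg : measurable_fun setT g) (g0 : forall x, (0 <= g x)%R) (A : set T) :=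
  \int[mu]_(x in A) (g x)%:E.

Section density_measure_instance.
Variables (mu : {measure set T -> \bar R}) (g : T -> R).
Hypotheses (mg : measurable_fun setT g) (g0 : forall x, (0 <= g x)%R).

Let density0 : density_measure mu mg g0 set0 = 0.
Proof. by rewrite /density_measure integral_set0. Qed.

Let density_ge0 A : 0 <= density_measure mu mg g0 A.
Proof. by apply: integral_ge0 => x _; rewrite lee_fin. Qed.

Let density_sigma_additive : semi_sigma_additive (density_measure mu mg g0).
Proof.
by apply: semi_sigma_additive_nng_induced => //; exact/measurable_EFinP.
Qed.

HB.instance Definition _ := isMeasure.Build _ _ _ (density_measure mu mg g0)
  density0 density_ge0 density_sigma_additive.
End density_measure_instance.

Import HBNNSimple.

(** Both sides pass to increasing limits of simple functions, and on an
    indicator the identity is the hypothesis on [nu]. *)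
Lemma ge0_integral_density (mu nu : {measure set T -> \bar R}) (g : T -> R)
    (f : T -> \bar R) :
  measurable_fun setT g -> (forall x, (0 <= g x)%R) ->
  (forall A, measurable A -> nu A = \int[mu]_(x in A) (g x)%:E) ->
  measurable_fun setT f -> (forall x, 0 <= f x) ->
  \int[nu]_x f x = \int[mu]_x (f x * (g x)%:E).
Proof.
move=> mg g0 nuE mf f0.
pose f_ := nnsfun_approx measurableT mf.
transitivity (limn (fun n => \int[nu]_x (f_ n x)%:E)).
  rewrite -monotone_convergence//.
  - by apply: eq_integral => x _; apply/esym/cvg_lim => //; apply: cvg_nnsfun_approx.
  - by move=> n; exact/measurable_EFinP/measurable_funTS.
  - by move=> *; rewrite lee_fin.
  - by move=> x _ m n mn; rewrite lee_fin; exact/lefP/nd_nnsfun_approx.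
transitivity (limn (fun n => \int[mu]_x ((f_ n x)%:E * (g x)%:E))); last first.
  rewrite -monotone_convergence//.
  - apply: eq_integral => x _; apply/cvg_lim => //.
    by apply: cvgeZr => //; apply: cvg_nnsfun_approx.
  - move=> n; apply: emeasurable_funM; first exact/measurable_EFinP/measurable_funTS.
    exact/measurable_EFinP.
  - by move=> *; rewrite mule_ge0// lee_fin.
  - move=> x _ m n mn; rewrite lee_wpmul2r ?lee_fin//.
    exact/lefP/nd_nnsfun_approx.
congr (limn _); apply/funext => n.
under eq_integral do rewrite fimfunE -fsumEFin//.
transitivity (\int[mu]_x \sum_(y \in range (f_ n))
    ((y * \1_(f_ n @^-1` [set y]) x)%:E * (g x)%:E)); last first.
  apply: eq_integral => x _; rewrite fimfunE -fsumEFin// ge0_mule_fsuml// => y.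
  by rewrite EFinM nnfun_muleindic_ge0.
rewrite !ge0_integral_fsum//; last 4 first.
- move=> y; apply: emeasurable_funM; last exact/measurable_EFinP.
  exact/measurable_EFinP/measurable_funM.
- move=> y x _; rewrite mule_ge0 ?lee_fin// -lee_fin EFinM.
  exact: nnfun_muleindic_ge0.
- by move=> y; exact/measurable_EFinP/measurable_funM.
- by move=> y x _; rewrite nnfun_muleindic_ge0.
apply: eq_fsbigr => y _.
rewrite integralZl_indic_nnsfun// integral_indic// setIT nuE//.
have [y0|y0] := leP 0%R y; last first.
  rewrite preimage_nnfun0// integral_set0 mule0.
  by rewrite integral0_eq// => x _; rewrite indic0 mulr0 mul0e.
under [RHS]eq_integral do rewrite EFinM -muleA.
rewrite [RHS]ge0_integralZl//; last first.
- by move=> x _; rewrite mule_ge0// lee_fin.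
- by apply: emeasurable_funM => //; exact/measurable_EFinP.
congr (_ * _); rewrite integral_mkcond/=; apply: eq_integral => x _.
by rewrite patchE indicE; case: ifP => _; rewrite ?mul1e ?mul0e.
Qed.

End Density.

Section FTC.
Context {R : realType}.
Notation mu := (@lebesgue_measure R).

Lemma integral_itv_oc_derive (f F : R -> R) (p q : R) : p <= q ->
  (forall x, p <= x <= q -> is_derive x 1 F (f x)) ->
  (forall x, p <= x <= q -> {for x, continuous f}) ->
  (\int[mu]_(x in `]p, q]) (f x)%:E)%E = (F q - F p)%:E.
Proof.
rewrite le_eqVlt => /predU1P[<- _ _|pq dF cf].
  by rewrite set_itvoc0 integral_set0 subrr.
have cf' : {within `[p, q], continuous f}.
  apply: continuous_in_subspaceT => x; rewrite inE/= in_itv/=; exact: cf.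
have cF x : p <= x <= q -> {for x, continuous F}.
  move=> /dF [dFx _]; exact/differentiable_continuous/derivable1_diffP.
have mf : measurable_fun `[p, q] f by exact: subspace_continuous_measurable_fun.
rewrite integral_itv_obnd_cbnd; last first.
  apply/measurable_EFinP; apply: measurable_funS mf => //.
  exact: subset_itv_oc_cc.
rewrite (@continuous_FTC2 _ _ F)// ?EFinB//.
- split.
  + by move=> x; rewrite in_itv/= => /andP[/ltW px /ltW xq]; have [] := dF x _;
       rewrite ?px ?xq.
  + by apply: cvg_at_right_filter; apply: cF; rewrite lexx ltW.
  + by apply: cvg_at_left_filter; apply: cF; rewrite lexx ltW.
- move=> x; rewrite in_itv/= => /andP[/ltW px /ltW xq].
  rewrite derive1E; have [] := dF x _; rewrite ?px ?xq// => _; exact.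
Qed.

End FTC.

Section LogSubstitution.
Context {R : realType}.
Notation mu := (@lebesgue_measure R).

(** Density of the image of Lebesgue measure under z |-> exp (al + c z), which
    is the same for all al; [s `^ (-1)] makes its measurability immediate. *)
Definition inv_pos (c s : R) : R := c^-1 * (s `^ (-1) * \1_(`]0, +oo[) s).

Lemma inv_pos_ge0 (c s : R) : 0 < c -> 0 <= inv_pos c s.
Proof.
by move=> c0; rewrite mulr_ge0 ?invr_ge0 ?(ltW c0)// mulr_ge0 ?powR_ge0.
Qed.

Lemma measurable_inv_pos (c : R) : measurable_fun setT (inv_pos c).
Proof.
by apply: measurable_funM => //; apply: measurable_funM.
Qed.

Lemma inv_posE (c s : R) : 0 < s -> inv_pos c s = (c * s)^-1.
Proof.
move=> s0; rewrite /inv_pos indicE mem_set/= ?in_itv/= ?s0// mulr1.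
by rewrite powR_inv1 ?ltW// invfM.
Qed.

Lemma inv_pos0 (c s : R) : s <= 0 -> inv_pos c s = 0.
Proof.
by move=> s0; rewrite /inv_pos indicE memNset ?mulr0//= in_itv/= andbT ltNge s0.
Qed.

Lemma integral_inv_pos (c p q : R) : 0 < p -> p <= q ->
  (\int[mu]_(s in `]p, q]) (inv_pos c s)%:E)%E = (c^-1 * (ln q - ln p))%:E.
Proof.
move=> p0 pq.
have sp s : p <= s <= q -> 0 < s by move=> /andP[+ _]; exact: lt_le_trans.
have dF s : p <= s <= q -> is_derive s 1 (fun s => c^-1 * ln s) (c^-1 * s^-1).
  move=> /sp s0; have ? := is_derive1_ln s0.
  exact: (@is_deriveZ _ _ _ (@ln R) c^-1).
have cf s : p <= s <= q -> {for s, continuous (fun s : R => c^-1 * s^-1)}.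
  move=> /sp s0; apply: cvgM; first exact: cvg_cst.
  by apply: inv_continuous; rewrite gt_eqF.
rewrite mulrBr -(integral_itv_oc_derive pq dF cf); apply: eq_integral => s.
rewrite inE/= in_itv/= => /andP[/ltW ps sq].
by rewrite inv_posE ?invfM ?(sp s) ?ps.
Qed.

(** The map s |-> (ln s - al) / c pushes the measure of density [inv_pos c]
    forward to Lebesgue measure, because every interval ]u, v] receives the mass
    v - u and such masses determine a measure on the line. *)
Lemma integral_expR_affine (al c : R) (f : R -> \bar R) : 0 < c ->
  measurable_fun setT f -> (forall x, 0 <= f x)%E ->
  (\int[mu]_z f (expR (al + c * z)) =
   \int[mu]_s (f s * (inv_pos c s)%:E))%E.
Proof.
move=> c0 mf f0.
pose D := density_measure mu (measurable_inv_pos c) (fun s => inv_pos_ge0 s c0).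
pose psi (s : R) : measurableTypeR R := (ln s - al) / c.
have mpsi : measurable_fun setT psi.
  apply: measurable_funM => //; apply: measurable_funB => //; exact: measurable_ln.
have mE : measurable_fun setT (fun z : R => expR (al + c * z)).
  apply: measurableT_comp; first exact: measurable_expR.
  by apply: measurable_funD => //; exact: measurable_funM.
have muE A : measurable A -> mu A = pushforward D psi A.
  move=> mA; apply: lebesgue_measure_unique => //.
  move=> _ [[u v] _ <-] /=.
  rewrite lebesgue_measure_itv/= lte_fin /pushforward.
  rewrite /density_measure.
  transitivity (\int[mu]_(s in `]expR (al + c * u), expR (al + c * v)]) (inv_pos c s)%:E)%E.
    case: ltP => uv; last first.
      rewrite set_itv_ge ?integral_set0// bnd_simp -leNgt ler_expR lerD2l.
      by rewrite ler_pM2l.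
    rewrite integral_inv_pos ?expR_gt0 ?ler_expR ?lerD2l ?ler_pM2l ?(ltW uv)//.
    rewrite !expRK; congr EFin; field; exact: lt0r_neq0.
  rewrite [LHS]integral_mkcond [RHS]integral_mkcond.
  congr integral; apply/funext => s.
  rewrite !patchE; have [s0|s0] := leP s 0.
    by rewrite inv_pos0 //; do 2 case: ifP.
  congr (if _ then _ else _); apply/idP/idP; rewrite !inE /psi/= !in_itv/=.
    move=> /andP[]; rewrite -[s in _ < s -> _]lnK// -[s in s <= _ -> _]lnK//.
    rewrite ltr_expR ler_expR ltr_pdivlMr// ler_pdivrMr//.
    by move=> ? ?; apply/andP; split; lra.
  move=> /andP[]; rewrite ltr_pdivlMr// ler_pdivrMr// => us sv.
  rewrite -[s]lnK// ltr_expR ler_expR; apply/andP; split; lra.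
transitivity (\int[pushforward D psi]_z f (expR (al + c * z)))%E.
  by apply: eq_measure_integral => A mA _; exact: muE.
rewrite ge0_integral_pushforward//; last first.
  exact: measurableT_comp.
rewrite preimage_setT.
rewrite (@ge0_integral_density _ _ _ mu D (inv_pos c))//; last 4 first.
- exact: measurable_inv_pos.
- by move=> s; exact: inv_pos_ge0.
- by apply: measurableT_comp => //; exact: measurableT_comp.
- by move=> s; exact: f0.
apply: eq_integral => s _ /=.
have [s0|s0] := leP s 0; first by rewrite inv_pos0// !mule0.
congr (f _ * _)%E; rewrite /psi mulrC divfK ?gt_eqF// addrC subrK lnK//.
Qed.
End LogSubstitution.

(** * One time step: moments of the Gaussian noise *)

Section GaussianMoments.
Context {R : realType}.
Notation mu := (@lebesgue_measure R).

Lemma ge0_integral_opp (f : R -> \bar R) :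
  measurable_fun setT f -> (forall x, 0 <= f x)%E ->
  (\int[mu]_z f z = \int[mu]_z f (- z)%R)%E.
Proof.
move=> mf f0.
transitivity (\int[pushforward mu (-%R : _ -> measurableTypeR R)]_z f z)%E.
  by apply: eq_measure_integral => //= A mA _; exact/esym/lebesgue_measureN.
by rewrite ge0_integral_pushforward.
Qed.

Lemma ge0_integral_normal (m s : R) (f : R -> \bar R) :
  measurable_fun setT f -> (forall x, 0 <= f x)%E ->
  (\int[normal_prob m s]_z f z = \int[mu]_z (f z * (normal_pdf m s z)%:E))%E.
Proof.
move=> mf f0; apply: ge0_integral_density => //.
- exact: measurable_normal_pdf.
- exact: normal_pdf_ge0.
Qed.

Lemma normal_pdfN (s z : R) : s != 0 -> normal_pdf 0 s (- z) = normal_pdf 0 s z.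
Proof.
by move=> s0; rewrite normal_pdfE//= /normal_fun !subr0 sqrrN.
Qed.

Lemma normal_mgf (s l : R) : s != 0 ->
  (\int[normal_prob 0 s]_z (expR (l * z))%:E = (expR (l ^+ 2 * s ^+ 2 / 2))%:E)%E.
Proof.
move=> s0; rewrite ge0_integral_normal//; last first.
  apply/measurable_EFinP; apply: measurableT_comp; first exact: measurable_expR.
  exact: measurable_funM.
under eq_integral => z _.
  rewrite -EFinM normal_pdfE//= mulrCA -expRD subr0.
  (* completing the square: a normal density of mean l * s ^+ 2 appears *)
  rewrite (_ : l * z + _ =
    l ^+ 2 * s ^+ 2 / 2 + - (z - l * s ^+ 2) ^+ 2 / (s ^+ 2 *+ 2)); last by field.
  rewrite expRD mulrCA -[X in (_ * X)%:E]/(normal_peak s * normal_fun (l * s ^+ 2) s z).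
  rewrite EFinM; over.
rewrite ge0_integralZl//.
- under eq_integral do rewrite
    -[normal_peak _ * _]/((fun x => normal_peak s * normal_fun (l * s ^+ 2) s x) _)
    -(normal_pdfE _ s0).
  by rewrite integral_normal_pdf mule1.
- apply/measurable_EFinP; apply: measurable_funM => //; exact: measurable_normal_fun.
- by move=> x _; rewrite lee_fin mulr_ge0 ?normal_peak_ge0 ?normal_fun_ge0.
Qed.

Lemma integrable_normal_expR (s l : R) : s != 0 ->
  (normal_prob 0 s).-integrable setT (EFin \o (fun z => expR (l * z))).
Proof.
move=> s0; apply/integrableP; split.
  apply/measurable_EFinP; apply: measurableT_comp; first exact: measurable_expR.
  exact: measurable_funM.
under eq_integral do rewrite /= ger0_norm ?expR_ge0//.
by rewrite normal_mgf// ltry.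
Qed.

Lemma normr_le_expR (z : R) : `|z| <= expR (1 * z) + expR (-1 * z).
Proof.
rewrite mul1r mulN1r; have := expR_ge1Dx z; have := expR_ge1Dx (- z).
have := expR_ge0 z; have := expR_ge0 (- z).
by rewrite ler_norml => *; apply/andP; split; lra.
Qed.

Lemma integrable_normal_id (s : R) : s != 0 ->
  (normal_prob 0 s).-integrable setT (EFin \o (fun z => z)).
Proof.
move=> s0.
have i1 := integrable_normal_expR 1 s0.
have i2 := integrable_normal_expR (-1) s0.
apply: le_integrable (integrableD measurableT i1 i2) => //.
  exact/measurable_EFinP.
move=> z _; rewrite lee_fin.
by rewrite (le_trans (normr_le_expR z))// ler_norm.
Qed.

(** The positive and negative parts of z have equal integrals because the
    density is even. *)
Lemma normal_mean0 (s : R) : s != 0 -> (\int[normal_prob 0 s]_z z%:E = 0)%E.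
Proof.
move=> s0; have iz := integrable_normal_id s0.
rewrite integralE (_ : \int[_]_z _ = \int[normal_prob 0 s]_z ((EFin \o id)^\- z))%E.
  rewrite subee//; apply: integrable_fin_num => //; exact: integrable_funeneg.
have mid : measurable_fun setT (EFin \o (@id R)) by exact/measurable_EFinP.
rewrite !ge0_integral_normal//; last 2 first.
- exact: (measurable_funepos mid).
- exact: (measurable_funeneg mid).
rewrite ge0_integral_opp; last 2 first.
- apply: emeasurable_funM; first exact: (measurable_funepos mid).
  by apply/measurable_EFinP; exact: measurable_normal_pdf.
- by move=> z; rewrite mule_ge0// lee_fin normal_pdf_ge0.
apply: eq_integral => z _; rewrite normal_pdfN//.
by congr (_ * _)%E; rewrite funeposE funenegE /= EFinN.
Qed.

Lemma expR_taylor1 (y : R) : `|expR y - 1 - y| <= y ^+ 2 * expR `|y|.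
Proof.
have h1 := expR_ge1Dx y; rewrite ger0_norm; last by lra.
have h2 : expR y * (1 - y) <= 1.
  have := expR_ge1Dx (- y); rewrite -(@ler_pM2l _ (expR y)) ?expR_gt0//.
  by rewrite expRxMexpNx_1.
have e0 := expR_gt0 y.
have [y0|y0] := leP 0 y.
  have -> : `|y| = y by rewrite ger0_norm.
  have : y * (expR y - 1) <= y * (y * expR y) by rewrite ler_wpM2l//; lra.
  rewrite expr2; nra.
have e1 : 1 <= expR `|y| by rewrite -expR0 ler_expR.
have : y ^+ 2 * 1 <= y ^+ 2 * expR `|y| by rewrite ler_wpM2l// sqr_ge0.
apply: le_trans; rewrite expr2 mulr1; nra.
Qed.

Lemma sqr_le_expR (u : R) : 0 <= u -> u ^+ 2 <= 2 * expR u.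
Proof.
move=> u0; have := expR_ge1Dxn 1 u0; rewrite (_ : 2`!%:R = 2)//; lra.
Qed.

(** A step of length dt with Brownian increment z multiplies the geometric
    Brownian motion by exp (a dt + c z). Removing the Ito increment c z and the
    mean growth leaves a centred variable whose standard deviation is of order
    dt, whereas that of c z is only of order sqrt dt; the t / dt steps up to time
    t then contribute a variance of order dt. *)
Definition gbm_noise (a c dt z : R) :=
  expR (a * dt + c * z) - c * z - expR ((a + c ^+ 2 / 2) * dt).

(** What remains after the first-order terms cancel is quadratic in z and
    linear in dt. With u = |z| / sqrt dt, which has the law of the absolute value
    of a standard normal variable, z ^ 2 = dt u ^ 2, and the other factors are
    bounded by exponentials of u uniformly in dt <= 1. *)
Lemma gbm_noise_bound (a c : R) : exists2 C : R, 0 <= C &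
  forall dt z, 0 < dt -> dt <= 1 ->
  `|gbm_noise a c dt z| <=
  C * dt * expR ((1 + `|c|) * (`|z| / Num.sqrt dt)).
Proof.
set b := a + c ^+ 2 / 2.
pose K1 := b ^+ 2 * expR `|b| + `|b - a|.
pose K0 := 2 * (a ^+ 2 + 2 * c ^+ 2) * expR `|a|.
have K10 : 0 <= K1 by rewrite addr_ge0// mulr_ge0 ?sqr_ge0 ?expR_ge0.
have K00 : 0 <= K0.
  by rewrite mulr_ge0 ?expR_ge0// mulr_ge0// addr_ge0 ?sqr_ge0// mulr_ge0 ?sqr_ge0.
exists (K0 + K1); first exact: addr_ge0.
move=> dt z dt0 dt1.
set s := Num.sqrt dt; set u := `|z| / s.
have s0 : 0 < s by rewrite sqrtr_gt0.
have s2 : s ^+ 2 = dt by rewrite sqr_sqrtr// ltW.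
have u0 : 0 <= u by rewrite divr_ge0// ltW.
have zE : `|z| = u * s by rewrite /u divfK// gt_eqF.
have s1 : s <= 1 by rewrite -(@expr_le1 _ 2)// ?s2// ltW.
set y := a * dt + c * z.
have -> : gbm_noise a c dt z =
    (expR y - 1 - y) - (expR (b * dt) - 1 - b * dt) - (b - a) * dt.
  by rewrite /gbm_noise -/b -/y /y; ring.
set E := expR ((1 + `|c|) * u).
have E1 : 1 <= E by rewrite -expR0 ler_expR mulr_ge0// addr_ge0.
have h1 : `|expR y - 1 - y| <= K0 * dt * E.
  apply: (le_trans (expR_taylor1 y)).
  have hy2 : y ^+ 2 <= 2 * dt * (a ^+ 2 + 2 * c ^+ 2) * expR u.
    have hz2 : z ^+ 2 = u ^+ 2 * dt.
      by rewrite -real_normK ?num_real// zE exprMn s2.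
    have hu := sqr_le_expR u0.
    have e1 : 1 <= expR u by rewrite -expR0 ler_expR.
    have : y ^+ 2 <= 2 * (a ^+ 2 * dt ^+ 2 + c ^+ 2 * z ^+ 2).
      have := sqr_ge0 (a * dt - c * z); rewrite /y; nra.
    move=> /le_trans; apply; rewrite hz2.
    have d2 : dt ^+ 2 <= dt by rewrite expr2; nra.
    have A1 : a ^+ 2 * dt ^+ 2 <= a ^+ 2 * dt * expR u.
      rewrite -mulrA ler_wpM2l ?sqr_ge0//; nra.
    have A2 : c ^+ 2 * (u ^+ 2 * dt) <= c ^+ 2 * (2 * expR u * dt).
      by rewrite ler_wpM2l ?sqr_ge0// ler_wpM2r// ltW.
    lra.
  have hey : expR `|y| <= expR `|a| * expR (`|c| * u).
    rewrite -expRD ler_expR; apply: (le_trans (ler_normD _ _)).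
    rewrite !normrM lerD//.
      by rewrite ler_piMr// ger0_norm// ltW.
    by rewrite ler_wpM2l// zE ler_piMr.
  apply: (le_trans (ler_pM (sqr_ge0 _) (expR_ge0 _) hy2 hey)).
  have -> : E = expR u * expR (`|c| * u) by rewrite -expRD /E mulrDl mul1r.
  by rewrite le_eqVlt; apply/orP; left; apply/eqP; rewrite /K0; ring.
have h2 : `|expR (b * dt) - 1 - b * dt| <= b ^+ 2 * expR `|b| * dt.
  apply: (le_trans (expR_taylor1 _)).
  have d2 : (b * dt) ^+ 2 <= b ^+ 2 * dt.
    by rewrite exprMn ler_wpM2l ?sqr_ge0// expr2; nra.
  have e2 : expR `|b * dt| <= expR `|b|.
    by rewrite ler_expR normrM ler_piMr// ger0_norm// ltW.
  by rewrite [leRHS]mulrAC; apply: ler_pM => //; rewrite ?expR_ge0 ?sqr_ge0.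
have h3 : `|(b - a) * dt| <= `|b - a| * dt by rewrite normrM (gtr0_norm dt0).
apply: (le_trans (ler_normB _ _)).
apply: (le_trans (lerD (ler_normB _ _) h3)).
have : K1 * dt <= K1 * dt * E by rewrite ler_peMr// mulr_ge0// ltW.
rewrite {1}/K1; lra.
Qed.

Lemma measurable_gbm_noise (a c dt : R) :
  measurable_fun setT (gbm_noise a c dt).
Proof.
apply: measurable_funB => //; apply: measurable_funB; last exact: measurable_funM.
apply: measurableT_comp; first exact: measurable_expR.
by apply: measurable_funD => //; exact: measurable_funM.
Qed.

Lemma integrable_gbm_noise (a c dt : R) : 0 < dt ->
  (normal_prob 0 (Num.sqrt dt)).-integrable setT (EFin \o gbm_noise a c dt).
Proof.
move=> dt0; have s0 : Num.sqrt dt != 0 by rewrite gt_eqF// sqrtr_gt0.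
have i1 := integrableZl measurableT (expR (a * dt)) (integrable_normal_expR c s0).
have i2 := integrableZl measurableT c (integrable_normal_id s0).
have i3 := finite_measure_integrable_cst (normal_prob 0 (Num.sqrt dt))
  (expR ((a + c ^+ 2 / 2) * dt)) measurableT.
have := integrableB measurableT (integrableB measurableT i1 i2) i3.
apply: eq_integrable => // z _.
by rewrite /gbm_noise /= expRD !EFinB !EFinM.
Qed.

Lemma gbm_noise_mean0 (a c dt : R) : 0 < dt ->
  (\int[normal_prob 0 (Num.sqrt dt)]_z (gbm_noise a c dt z)%:E = 0)%E.
Proof.
move=> dt0; have s0 : Num.sqrt dt != 0 by rewrite gt_eqF// sqrtr_gt0.
have i1 := integrableZl measurableT (expR (a * dt)) (integrable_normal_expR c s0).
have i2 := integrableZl measurableT c (integrable_normal_id s0).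
have i3 := finite_measure_integrable_cst (normal_prob 0 (Num.sqrt dt))
  (expR ((a + c ^+ 2 / 2) * dt)) measurableT.
under eq_integral do rewrite /gbm_noise expRD !EFinB !EFinM.
rewrite integralB//; last exact: (integrableB measurableT i1 i2).
rewrite integralB// integralZl//; last exact: integrable_normal_expR.
rewrite integralZl//; last exact: integrable_normal_id.
rewrite normal_mgf// normal_mean0// mule0 sube0 integral_cst//.
rewrite [X in (_ - _ * X)%E](probability_setT (normal_prob 0 (Num.sqrt dt))).
rewrite mule1 -EFinM -expRD sqr_sqrtr ?(ltW dt0)//.
rewrite (_ : a * dt + _ = (a + c ^+ 2 / 2) * dt); last by field.
by rewrite subee.
Qed.

(** Squaring the previous bound leaves an exponential moment of z / sqrt dt,
    which is independent of dt. *)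
Lemma gbm_noise_variance (a c : R) : exists2 C : R, 0 <= C &
  forall dt, 0 < dt -> dt <= 1 ->
  (\int[normal_prob 0 (Num.sqrt dt)]_z (gbm_noise a c dt z ^+ 2)%:E
   <= (C * dt ^+ 2)%:E)%E.
Proof.
have [K K0 HK] := gbm_noise_bound a c.
pose k := 2 * (1 + `|c|).
exists (K ^+ 2 * (2 * expR (k ^+ 2 / 2))).
  by rewrite mulr_ge0 ?sqr_ge0// mulr_ge0// expR_ge0.
move=> dt dt0 dt1; set s := Num.sqrt dt.
have s0 : s != 0 by rewrite gt_eqF// sqrtr_gt0.
have s2 : s ^+ 2 = dt by rewrite sqr_sqrtr// ltW.
have me l : measurable_fun setT (fun z : R => (expR (l * z))%:E).
  apply/measurable_EFinP; apply: measurableT_comp; first exact: measurable_expR.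
  exact: measurable_funM.
have K20 : 0 <= (K * dt) ^+ 2 by exact: sqr_ge0.
have -> : (K ^+ 2 * (2 * expR (k ^+ 2 / 2)) * dt ^+ 2)%:E =
   (\int[normal_prob 0 s]_z (((K * dt) ^+ 2)%:E *
      ((expR (k / s * z))%:E + (expR (- (k / s) * z))%:E)))%E.
  rewrite ge0_integralZl//; last 2 first.
  - by apply: emeasurable_funD; exact: me.
  - by move=> z _; rewrite adde_ge0// lee_fin expR_ge0.
  rewrite ge0_integralD//; last 2 first.
  - exact: me.
  - exact: me.
  rewrite !normal_mgf// -EFinD -EFinM sqrrN.
  have -> : (k / s) ^+ 2 * s ^+ 2 = k ^+ 2 by rewrite expr_div_n divfK// expf_neq0.
  by congr EFin; ring.
apply: ge0_le_integral => //.
- by move=> z _; rewrite lee_fin sqr_ge0.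
- apply/measurable_EFinP; apply: measurable_funX; exact: measurable_gbm_noise.
- by apply: emeasurable_funM => //; apply: emeasurable_funD; exact: me.
move=> z _; rewrite -EFinD -EFinM lee_fin.
have := HK dt z dt0 dt1; rewrite -/s => hK.
rewrite -(real_normK (num_real (gbm_noise _ _ _ _))).
apply: (@le_trans _ _ ((K * dt * expR ((1 + `|c|) * (`|z| / s))) ^+ 2)).
  by rewrite lerXn2r// nnegrE// mulr_ge0 ?expR_ge0// mulr_ge0// ltW.
rewrite exprMn ler_wpM2l// -expRM_natl.
have -> : 2%:R * ((1 + `|c|) * (`|z| / s)) = k / s * `|z| by rewrite /k; field.
have e1 := expR_ge0 (k / s * z); have e2 := expR_ge0 (- (k / s) * z).
have [z0|z0] := leP 0 z.
  by rewrite (ger0_norm z0); lra.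
by rewrite (ltr0_norm z0) mulrN -mulNr; lra.
Qed.

End GaussianMoments.

(** * Second moments along a grid: orthogonality of the steps *)

Section Brownian.
Context {R : realType} {d : measure_display} {T : measurableType d}.
Variables (P : probability T R) (F : R -> set (set T)) (W : R -> T -> R).
Hypotheses (hF : is_filtration F) (hW : is_brownian_motion P F W).

Lemma brownian_measurable (t : R) : 0 <= t -> measurable_fun setT (W t).
Proof.
move=> t0 _ B mB; rewrite setTI; apply: (filtration_measurable hF t0).
exact: (brownian_adapted hW).
Qed.

(** Measurability with respect to F t is measurability on
    [g_sigma_algebraType (F t)]; in this form sums, products and compositions of
    variables of the past are handled like any measurable functions. *)
Lemma brownian_past (s t : R) : 0 <= s -> s <= t ->
  measurable_fun setT (W s : g_sigma_algebraType (F t) -> R).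
Proof.
move=> s0 st _ B mB; rewrite setTI; apply: sub_sigma_algebra.
apply: (filtration_nondecreasing hF s0 st); exact: (brownian_adapted hW).
Qed.

Lemma past_event (s : R) d' (U : measurableType d') (V : T -> U) : 0 <= s ->
  measurable_fun setT (V : g_sigma_algebraType (F s) -> U) ->
  forall B, measurable B -> F s (V @^-1` B).
Proof.
move=> s0 mV B mB.
have := mV measurableT B mB; rewrite setTI.
by rewrite /measurable/= sigma_algebra_id//; exact: (filtration_sigma_algebra hF).
Qed.

Lemma past_measurable (s : R) d' (U : measurableType d') (V : T -> U) : 0 <= s ->
  measurable_fun setT (V : g_sigma_algebraType (F s) -> U) ->
  measurable_fun setT V.
Proof.
move=> s0 mV _ B mB; rewrite setTI; apply: (filtration_measurable hF s0).
exact: past_event.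
Qed.

(** Independence and the Gaussian law give the joint law of V and the increment
    on rectangles, where it agrees with a product measure; so it is that product,
    and Tonelli's theorem averages over the increment with the past frozen. *)
Lemma brownian_integral_past d' (U : measurableType d') (V : T -> U) (s t : R)
    (f : U * measurableTypeR R -> \bar R) : 0 <= s -> s < t ->
  measurable_fun setT (V : g_sigma_algebraType (F s) -> U) ->
  measurable_fun setT f -> (forall x, 0 <= f x)%E ->
  (\int[P]_w f (V w, (W t w - W s w)%R) =
   \int[P]_w \int[normal_prob 0 (Num.sqrt (t - s))]_z f (V w, z))%E.
Proof.
move=> s0 st mV mf f0.
have mV' := past_measurable s0 mV.
have mD : measurable_fun setT (fun w => W t w - W s w : measurableTypeR R).
  by apply: measurable_funB; apply: brownian_measurable => //; lra.
have mVD : measurable_fun setT (fun w => (V w, W t w - W s w : measurableTypeR R)).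
  exact: measurable_fun_pair.
pose N := normal_prob 0 (Num.sqrt (t - s)).
pose phi := mfun_Sub (mem_set mV' : V \in mfun).
pose psi := mfun_Sub (mem_set mVD : _ \in mfun).
have prodE := @product_measure_unique _ _ U (measurableTypeR R) R (distribution P phi)
  (normal_prob 0 (Num.sqrt (t - s))) (distribution P psi).
have {}prodE (C : set (U * measurableTypeR R)) : measurable C ->
    (distribution P phi \x N)%E C = distribution P psi C.
  move=> mC; apply: prodE => // A B mA mB.
  transitivity (P (V @^-1` A) * P ((fun w => (W t w - W s w)%R) @^-1` B))%E.
    by rewrite -(brownian_independent hW s0 st)//; exact: past_event.
  by congr (_ * _)%E; exact: (brownian_gaussian hW s0 st mB).
transitivity (\int[distribution P psi]_x f x)%E.
  by rewrite ge0_integral_distribution.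
transitivity (\int[distribution P phi \x N]_x f x)%E.
  by apply: eq_measure_integral => C mC _; exact/esym/prodE.
rewrite fubini_tonelli1//.
rewrite ge0_integral_distribution//.
- exact: measurable_fun_fubini_tonelli_F.
- by move=> u; apply: integral_ge0.
Qed.

Lemma brownian_integral s (f : R -> \bar R) : 0 < s ->
  measurable_fun setT f -> (forall x, 0 <= f x)%E ->
  (\int[P]_w f (W s w) = \int[normal_prob 0 (Num.sqrt s)]_z f z)%E.
Proof.
move=> s0 mf f0.
have := @brownian_integral_past _ R (cst 0) 0 s (f \o snd) (lexx _) s0.
rewrite subr0 => /(_ _ _ _)/=.
under eq_integral do rewrite (brownian_start hW) subr0.
move=> ->//.
- by rewrite integral_cst// [X in (_ * X)%E](probability_setT P) mule1.
- exact: measurableT_comp.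
Qed.

End Brownian.

Section NoiseStep.
Context {R : realType}.

(** The cross term 2 S X g integrates to 0. *)
Lemma integral_sqr_affine (nu : probability (measurableTypeR R) R) (g : R -> R) (S X v : R) :
  nu.-integrable setT (EFin \o g) -> (\int[nu]_z (g z)%:E = 0)%E ->
  (\int[nu]_z (g z ^+ 2)%:E = v%:E)%E ->
  (\int[nu]_z ((S + X * g z) ^+ 2)%:E = (S ^+ 2 + X ^+ 2 * v)%:E)%E.
Proof.
move=> ig g0 gv.
have mg : measurable_fun setT g by have /integrableP[/measurable_EFinP] := ig.
have ig2 : nu.-integrable setT (fun z => (g z ^+ 2)%:E).
  apply/integrableP; split.
    by apply/measurable_EFinP; exact: measurable_funX.
  under eq_integral do rewrite gee0_abs ?lee_fin ?sqr_ge0//.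
  by rewrite gv ltry.
have i1 := integrableZl measurableT (2 * S * X) ig.
have i2 := integrableZl measurableT (X ^+ 2) ig2.
have i0 := finite_measure_integrable_cst nu (S ^+ 2) measurableT.
transitivity (\int[nu]_z ((EFin \o cst (S ^+ 2)%R) z +
    (2 * S * X)%:E * (EFin \o g) z + (X ^+ 2)%:E * (g z ^+ 2)%:E))%E.
  by apply: eq_integral => z _ /=; rewrite -!EFinM -!EFinD; congr EFin; ring.
rewrite integralD//; last exact: (integrableD measurableT i0 i1).
rewrite integralD// !integralZl//= g0 gv mule0 adde0 integral_cst//.
by rewrite [X in (_ * X + _)%E](probability_setT nu) mule1.
Qed.
End NoiseStep.

Section GBM.
Context {R : realType} {d : measure_display} {T : measurableType d}.
Variables (P : probability T R) (F : R -> set (set T)) (W : R -> T -> R).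
Hypotheses (hF : is_filtration F) (hW : is_brownian_motion P F W).
Variables (a c x : R).

Definition gbm (t : R) (w : T) : R := x * expR (a * t + c * W t w).

Lemma measurable_gbm_fun (t : R) :
  measurable_fun setT (fun y : R => x * expR (a * t + c * y)).
Proof.
apply: measurable_funM => //; apply: measurableT_comp; first exact: measurable_expR.
by apply: measurable_funD => //; exact: measurable_funM.
Qed.

Lemma gbm_past (s t : R) : 0 <= s -> s <= t ->
  measurable_fun setT (gbm s : g_sigma_algebraType (F t) -> R).
Proof.
move=> s0 st.
exact: (measurableT_comp (measurable_gbm_fun s) (brownian_past hF hW s0 st)).
Qed.

Lemma gbm_measurable (t : R) : 0 <= t -> measurable_fun setT (gbm t).
Proof.
move=> t0.
exact: (measurableT_comp (measurable_gbm_fun t) (brownian_measurable hF hW t0)).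
Qed.

(** The exponential moment of a Gaussian variable. *)
Lemma gbm_second_moment (s : R) : 0 <= s ->
  (\int[P]_w (gbm s w ^+ 2)%:E = (x ^+ 2 * expR ((2 * a + 2 * c ^+ 2) * s))%:E)%E.
Proof.
rewrite le_eqVlt => /predU1P[<-|s0].
  under eq_integral do rewrite /gbm (brownian_start hW) !mulr0 addr0 expR0 mulr1.
  rewrite mulr0 expR0 mulr1 integral_cst//.
  by rewrite [X in (_ * X)%E](probability_setT P) mule1.
have me l : measurable_fun setT (fun z : R => (expR (l * z))%:E).
  apply/measurable_EFinP; apply: measurableT_comp; first exact: measurable_expR.
  exact: measurable_funM.
pose f (z : R) := ((x ^+ 2 * expR (2%:R * (a * s)))%:E * (expR (2%:R * c * z))%:E)%E.
transitivity (\int[P]_w f (W s w))%E.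
  apply: eq_integral => w _; rewrite /gbm /f -EFinM; congr EFin.
  by rewrite exprMn -expRM_natl mulrDr expRD [2 * (c * _)]mulrA; ring.
rewrite (brownian_integral hF hW s0)//.
- rewrite ge0_integralZl//; last 2 first.
  + exact: me.
  + by rewrite lee_fin mulr_ge0 ?sqr_ge0 ?expR_ge0.
  rewrite normal_mgf ?gt_eqF ?sqrtr_gt0// sqr_sqrtr ?(ltW s0)// -EFinM.
  by congr EFin; rewrite -[LHS]mulrA -expRD; congr (_ * expR _); field.
- by apply: emeasurable_funM.
- by move=> z; rewrite mule_ge0// lee_fin ?expR_ge0// mulr_ge0 ?sqr_ge0 ?expR_ge0.
Qed.

Section grid.
Variables (dt : R).
Hypothesis dt0 : 0 < dt.

(** The part of X minus its Ito sum along the grid of step dt that is due to the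
    noise: a martingale in n. *)
Definition gbm_defect (n : nat) (w : T) : R :=
  \sum_(k < n) gbm (k%:R * dt) w *
    gbm_noise a c dt (W (k.+1%:R * dt) w - W (k%:R * dt) w).

Lemma gbm_defect_past (n : nat) :
  measurable_fun setT (gbm_defect n : g_sigma_algebraType (F (n%:R * dt)) -> R).
Proof.
have dtk (k : nat) : 0 <= k%:R * dt by rewrite mulr_ge0// ltW.
have dtn (k : nat) : (k <= n)%N -> k%:R * dt <= n%:R * dt.
  by move=> kn; rewrite ler_pM2r// ler_nat.
rewrite /gbm_defect.
have H (i : 'I_n) : measurable_fun setT ((fun w => gbm (i%:R * dt) w *
  gbm_noise a c dt (W (i.+1%:R * dt) w - W (i%:R * dt) w)) :
   g_sigma_algebraType (F (n%:R * dt)) -> R).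
  apply: measurable_funM; first by apply: gbm_past => //; apply: dtn; exact: ltnW.
  apply: (measurableT_comp (measurable_gbm_noise a c dt)).
  by apply: measurable_funB; apply: (brownian_past hF hW) => //; apply: dtn => //; exact: ltnW.
exact: measurable_sum.
Qed.

(** The new step is centred and independent of the past, so it is orthogonal to
    the sum of the previous ones. *)
Lemma gbm_defect_step (n : nat) (v : R) :
  (\int[normal_prob 0 (Num.sqrt dt)]_z (gbm_noise a c dt z ^+ 2)%:E = v%:E)%E ->
  (\int[P]_w (gbm_defect n.+1 w ^+ 2)%:E =
   \int[P]_w (gbm_defect n w ^+ 2)%:E +
   \int[P]_w (gbm (n%:R * dt) w ^+ 2)%:E * v%:E)%E.
Proof.
move=> hv.
have v0 : 0 <= v.
  by rewrite -lee_fin -hv integral_ge0// => z _; rewrite lee_fin sqr_ge0.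
have n0 : 0 <= n%:R * dt by rewrite mulr_ge0// ltW.
have nn : n%:R * dt < n.+1%:R * dt by rewrite ltr_pM2r// ltr_nat.
pose f (p : (R * R) * measurableTypeR R) : \bar R :=
  ((p.1.1 + p.1.2 * gbm_noise a c dt p.2) ^+ 2)%:E.
pose V (w : T) := (gbm_defect n w, gbm (n%:R * dt) w).
have mV : measurable_fun setT (V : g_sigma_algebraType (F (n%:R * dt)) -> R * R).
  by apply: measurable_fun_pair; [exact: gbm_defect_past|exact: gbm_past].
have mf : measurable_fun setT f.
  apply/measurable_EFinP; apply: measurable_funX; apply: measurable_funD.
    exact: measurableT_comp.
  apply: measurable_funM; first exact: measurableT_comp.
  by apply: measurableT_comp; first exact: measurable_gbm_noise.
have f0 p : (0 <= f p)%E by rewrite lee_fin sqr_ge0.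
transitivity (\int[P]_w f (V w, (W (n.+1%:R * dt) w - W (n%:R * dt) w)%R))%E.
  by apply: eq_integral => w _; rewrite /f/= /gbm_defect big_ord_recr.
rewrite (brownian_integral_past hF hW n0 nn mV mf f0).
have -> : n.+1%:R * dt - n%:R * dt = dt by rewrite -addn1 natrD; ring.
transitivity (\int[P]_w ((gbm_defect n w ^+ 2)%:E + (gbm (n%:R * dt) w ^+ 2)%:E * v%:E))%E.
  apply: eq_integral => w _; rewrite /f/=.
  rewrite (integral_sqr_affine _ _ (integrable_gbm_noise a c dt0) _ hv) ?EFinD//.
  exact: gbm_noise_mean0.
have mS : measurable_fun setT (fun w => (gbm_defect n w ^+ 2)%:E).
  by apply/measurable_EFinP; apply: measurable_funX;
     apply: (past_measurable hF n0); exact: gbm_defect_past.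
have mX : measurable_fun setT (fun w => (gbm (n%:R * dt) w ^+ 2)%:E).
  by apply/measurable_EFinP; apply: measurable_funX; exact: gbm_measurable.
rewrite ge0_integralD//.
- by rewrite ge0_integralZr// => w _; rewrite lee_fin sqr_ge0.
- by move=> w _; rewrite lee_fin sqr_ge0.
- by move=> w _; rewrite mule_ge0// lee_fin sqr_ge0.
- exact: emeasurable_funM.
Qed.

Lemma gbm_defect_bound (n : nat) (v M : R) :
  (\int[normal_prob 0 (Num.sqrt dt)]_z (gbm_noise a c dt z ^+ 2)%:E = v%:E)%E ->
  (forall k, (k < n)%N ->
    x ^+ 2 * expR ((2 * a + 2 * c ^+ 2) * (k%:R * dt)) <= M) ->
  (\int[P]_w (gbm_defect n w ^+ 2)%:E <= (n%:R * (M * v))%:E)%E.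
Proof.
move=> hv; elim: n => [|n IH] hM.
  rewrite mul0r integral0_eq// => w _.
  by rewrite /gbm_defect big_ord0 expr0n.
have v0 : 0 <= v.
  by rewrite -lee_fin -hv integral_ge0// => z _; rewrite lee_fin sqr_ge0.
rewrite (gbm_defect_step _ hv) gbm_second_moment; last by rewrite mulr_ge0// ltW.
rewrite -[in leRHS]addn1 natrD [in leRHS]mulrDl EFinD; apply: leeD.
  by apply: IH => k kn; apply: hM; rewrite ltnS ltnW.
by rewrite -EFinM lee_fin mul1r ler_wpM2r// hM.
Qed.
End grid.

End GBM.

(** * Riemann sums of continuous functions *)

Section Riemann.
Context {R : realType}.
Notation mu := (@lebesgue_measure R).

(** Processes are constrained at nonnegative times only. Composing with
    [Num.max s 0] turns their paths into functions continuous on the whole line,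
    the form in which they are used from here on. *)
Lemma continuous_max0 (f : R -> R) : {within `[0, +oo[, continuous f} ->
  continuous (fun s : R => f (Num.max s 0)).
Proof.
move=> /subspace_continuousP cf s.
have A0 : `[0, +oo[%classic (Num.max s 0) by rewrite /= in_itv/= andbT le_max lexx orbT.
apply: cvg_trans (cf _ A0) => U /= [e/= e0 HU].
have cm : {for s, continuous (fun s : R => Num.max s 0)}.
  by apply: continuous_max; [exact: cvg_id|exact: cvg_cst].
move/cvgrPdist_lt : cm => /(_ _ e0) [e' /= e'0 H].
exists e' => //= y /H xy; apply: HU => //=.
by rewrite in_itv/= andbT le_max lexx orbT.
Qed.

(** Heine's theorem; v is allowed to leave the segment, as the compactness
    argument covers the segment by balls of the line. *)
Lemma uniform_continuity_segment (f : R -> R) (p q e : R) : continuous f -> 0 < e ->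
  exists2 dl, 0 < dl & forall u v, p <= u <= q -> `|u - v| < dl -> `|f u - f v| < e.
Proof.
move=> cf e0.
have /compact_near_coveringP K := @segment_compact _ p q.
pose Q (dl u : R) := forall v, `|u - v| < dl -> `|f u - f v| < e.
have := K _ (0^'+) Q _ _; case.
  move=> x _; have e2 : 0 < e / 2 by rewrite divr_gt0.
  have /cvgrPdist_lt/(_ _ e2)[d0/= d00 H] := cf x.
  exists (ball x (d0 / 2), [set dl | dl < d0 / 2]) => /=.
    split; first by apply: nbhsx_ballx; rewrite divr_gt0.
    by exists (d0 / 2) => /=; rewrite ?divr_gt0// => y /=; rewrite sub0r normrN => /ltr_normlW.
  move=> [u dl] /= [xu dld] v uv.
  have h1 := H u; have h2 := H v.
  rewrite /ball/= in xu.
  have hu : `|f x - f u| < e / 2 by apply: h1; rewrite /ball_/=; lra.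
  have hv : `|f x - f v| < e / 2.
    apply: h2; rewrite /ball_/= -(subrKA u).
    by apply: (le_lt_trans (ler_normD _ _)); lra.
  rewrite -(subrKA (f x)); apply: (le_lt_trans (ler_normD _ _)).
  by rewrite [`|f u - f x|]distrC; lra.
move=> d0/= d00 H; exists (d0 / 2); first by rewrite divr_gt0.
move=> u v pq uv; apply: (H (d0 / 2)) uv => //=.
- by rewrite sub0r normrN ger0_norm; lra.
- lra.
Qed.

Lemma riemann_step (f : R -> R) (p q e : R) : continuous f -> p <= q ->
  (forall s, p <= s <= q -> `|f p - f s| <= e) ->
  `|\int[mu]_(s in `]p, q]) f s - f p * (q - p)| <= e * (q - p).
Proof.
move=> cf pq H.
have icst (k : R) : mu.-integrable `]p, q] (EFin \o cst k).
  by apply: (@integrableS _ _ _ mu `[p, q]) => //; [exact: subset_itv_oc_cc|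
    apply: continuous_compact_integrable; [exact: segment_compact|
    apply: continuous_subspaceT => ?; exact: cvg_cst]].
have intf : mu.-integrable `]p, q] (EFin \o f).
  by apply: (@integrableS _ _ _ mu `[p, q]) => //; [exact: subset_itv_oc_cc|
    apply: continuous_compact_integrable; [exact: segment_compact|
    exact: continuous_subspaceT]].
have vol k : \int[mu]_(s in `]p, q]) k = k * (q - p).
  rewrite Rintegral_cst//; have /= -> := lebesgue_measure_itv `]p, q].
  rewrite lte_fin.
  by move: pq; rewrite le_eqVlt => /predU1P[->|->]; rewrite ?ltxx ?subrr.
have up : \int[mu]_(s in `]p, q]) f s <= (f p + e) * (q - p).
  rewrite -vol; apply: le_Rintegral; [by []|exact: intf|exact: icst|].
  move=> s /=; rewrite in_itv/= => /andP[/ltW ps sq].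
  have := H s; rewrite ps sq => /(_ isT); rewrite ler_norml => /andP[]; lra.
have lo : (f p - e) * (q - p) <= \int[mu]_(s in `]p, q]) f s.
  rewrite -vol; apply: le_Rintegral; [by []|exact: icst|exact: intf|].
  move=> s /=; rewrite in_itv/= => /andP[/ltW ps sq].
  have := H s; rewrite ps sq => /(_ isT); rewrite ler_norml => /andP[]; lra.
move: up lo; move: (\int[_]_(_ in _) _) => I up lo.
by clear -up lo; rewrite ler_norml; apply/andP; split; lra.
Qed.

Lemma riemann_sum_cvg (f : R -> R) (t : R) : continuous f -> 0 < t ->
  \sum_(k < N) f (k%:R * t / N%:R) * (t / N%:R) @[N --> \oo] -->
  \int[mu]_(s in `[0, t]) f s.
Proof.
move=> cf t0; apply/cvgrPdist_le => e e0.
have et : 0 < e / t by rewrite divr_gt0.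
have [dl dl0 H] := @uniform_continuity_segment f 0 t (e / t) cf et.
near=> N.
have N0 : (0 < N)%N by near: N; exact: nbhs_infty_gt.
have NR : 0 < N%:R :> R by rewrite ltr0n.
set s := t / N%:R.
have s0 : 0 < s by rewrite divr_gt0.
have sdl : s < dl.
  rewrite /s ltr_pdivrMr// mulrC -ltr_pdivrMr//; near: N; exact: nbhs_infty_gtr.
have intf q : mu.-integrable `[0, q] (EFin \o f).
  apply: continuous_compact_integrable; first exact: segment_compact.
  exact: continuous_subspaceT.
have Hk (k : nat) : (k <= N)%N ->
   `|\int[mu]_(s in `[0, k%:R * s]) f s - \sum_(j < k) f (j%:R * t / N%:R) * s|
   <= e / t * (k%:R * s).
  elim: k => [_|k IH kN].
    rewrite big_ord0 mul0r mulr0 set_itv1 Rintegral_set1 subr0 normr0//.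
  have k1 : k%:R * s <= k.+1%:R * s by rewrite ler_pM2r// ler_nat.
  have kk0 : 0 <= k%:R * s by rewrite mulr_ge0// ltW.
  have diff : k.+1%:R * s - k%:R * s = s by rewrite -addn1 natrD; ring.
  have := @Rintegral_itvB _ f (BLeft 0) (BRight (k.+1%:R * s)) (k%:R * s) (intf _).
  rewrite !bnd_simp => /(_ kk0 k1) E.
  have := @riemann_step f (k%:R * s) (k.+1%:R * s) (e / t) cf k1.
  rewrite -E diff big_ord_recr/= -mulrA -/s => /(_ _) S1.
  have {}S1 := S1 _.
  have {}IH := IH (ltnW kN).
  have S2 : `|\int[mu]_(t0 in `[0, (k.+1%:R * s)]) f t0 -
      \int[mu]_(t0 in `[0, (k%:R * s)]) f t0 - f (k%:R * s) * s| <= e / t * s.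
    apply: S1 => u /andP[ku uk]; apply/ltW/H.
      rewrite kk0/= (_ : t = N%:R * s); last by rewrite /s mulrC divfK// gt_eqF.
      by rewrite ler_pM2r// ler_nat ltnW.
    by rewrite distrC ger0_norm ?subr_ge0//; lra.
  have -> : e / t * (k.+1%:R * s) = e / t * (k%:R * s) + e / t * s.
    by rewrite -mulrDr; congr (_ * _); lra.
  apply: le_trans (lerD IH S2); apply: le_trans (ler_normD _ _).
  by rewrite le_eqVlt; apply/orP; left; apply/eqP; congr (`|_|); ring.
have := Hk N (leqnn N).
have -> : N%:R * s = t by rewrite /s mulrC divfK// gt_eqF.
by rewrite divfK ?gt_eqF.
Unshelve. all: by end_near.
Qed.
End Riemann.

(** * Geometric Brownian motion solves the equation *)

Section InProbability.
Context {R : realType} {d : measure_display} {T : measurableType d}.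
Variable P : probability T R.

Lemma measurable_ge_norm (u : T -> R) (e : R) : measurable_fun setT u ->
  measurable [set w | e <= `|u w|].
Proof.
move=> mu; rewrite (_ : [set w | _] = (fun w => `|u w|) @^-1` `[e, +oo[).
  rewrite -[X in measurable X]setTI.
  by apply: (measurableT_comp (@normr_measurable R setT) mu).
by apply/seteqP; split => w /=; rewrite in_itv/= andbT.
Qed.

(** Dominated convergence for the indicators of the events. *)
Lemma pointwise_cvg_in_probability (u : nat -> T -> R) (e : R) : 0 < e ->
  (forall n, measurable_fun setT (u n)) ->
  (forall w, u n w @[n --> \oo] --> 0) ->
  P [set w | e <= `|u n w|] @[n --> \oo] --> 0%E.
Proof.
move=> e0 mu u0.
pose A n := [set w | e <= `|u n w|].
have mA n : measurable (A n) by exact: measurable_ge_norm.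
pose f_ n w : \bar R := (\1_(A n) w)%:E.
have [//|||||_ _] := @dominated_convergence _ T R P setT measurableT f_ (cst 0%E) (cst 1%E).
- by move=> n; apply/measurable_EFinP; exact: measurable_indic.
- exact: measurable_cst.
- apply: aeW => w _; apply: cvg_near_cst.
  have /cvgrPdist_lt/(_ _ e0) := u0 w; apply: filterS => n.
  rewrite sub0r normrN => ue; rewrite /f_ indicE memNset//= => /=.
  by apply/negP; rewrite -ltNge.
- by apply: finite_measure_integrable_cst.
- apply: aeW => w n _; rewrite /f_ indicE.
  by case: (_ \in _); rewrite /= ?normr1 ?normr0 lee_fin// ler01.
rewrite integral0; apply: cvg_trans; apply: near_eq_cvg; near=> n.
by rewrite /f_ /= integral_indic// setIT.
Unshelve. all: by end_near.
Qed.

(** Chebyshev's inequality. *)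
Lemma second_moment_in_probability (u : T -> R) (e : R) : 0 < e ->
  measurable_fun setT u ->
  ((e ^+ 2)%:E * P [set w | (e <= `|u w|)%R] <= \int[P]_w (u w ^+ 2)%:E)%E.
Proof.
move=> e0 mu; set A := [set w | _].
have mA : measurable A by exact: measurable_ge_norm.
have mu2 : measurable_fun setT (fun w => (u w ^+ 2)%:E).
  by apply/measurable_EFinP; exact: measurable_funX.
rewrite -integral_cst//.
apply: (@le_trans _ _ (\int[P]_(w in A) (u w ^+ 2)%:E)%E).
  apply: ge0_le_integral => //.
  - by move=> w _; rewrite lee_fin sqr_ge0.
  - exact: measurable_funTS.
  - move=> w Aw; rewrite lee_fin -(real_normK (num_real (u w))).
    by rewrite lerXn2r// nnegrE// ltW.
apply: ge0_subset_integral => //.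
by move=> w _; rewrite lee_fin sqr_ge0.
Qed.

Lemma cvg_in_probabilityD (u v s : nat -> T -> R) :
  (forall n, measurable_fun setT (u n)) -> (forall n, measurable_fun setT (v n)) ->
  (\forall n \near \oo, forall w, s n w = u n w + v n w) ->
  (forall e : R, 0 < e -> P [set w | e <= `|u n w|] @[n --> \oo] --> 0%E) ->
  (forall e : R, 0 < e -> P [set w | e <= `|v n w|] @[n --> \oo] --> 0%E) ->
  forall e : R, 0 < e -> P [set w | e <= `|s n w|] @[n --> \oo] --> 0%E.
Proof.
move=> mu mv sE cu cv e e0.
have e2 : 0 < e / 2 by rewrite divr_gt0.
have c0 : (P [set w | (e / 2 <= `|u n w|)%R] + P [set w | (e / 2 <= `|v n w|)%R])%E
    @[n --> \oo] --> 0%E.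
  by rewrite -(adde0 0%E); apply: cvgeD => //; [exact: cu|exact: cv].
apply: (squeeze_cvge _ (@cvg_cst _ _ _ _ _) c0); near=> n.
have sn : forall w, s n w = u n w + v n w by near: n.
have -> : [set w | e <= `|s n w|] = [set w | e <= `|u n w + v n w|].
  by apply/seteqP; split => w /=; rewrite sn.
rewrite measure_ge0/=; apply: le_trans (measureU2 _ _ _).
- apply: le_measure; rewrite ?inE.
  + by apply: measurable_ge_norm; exact: measurable_funD.
  + by apply: measurableU; exact: measurable_ge_norm.
  + move=> w /= h; apply/orP; move: h; apply: contraLR; rewrite negb_or -!ltNge.
    by move=> /andP[hu hv]; apply: (le_lt_trans (ler_normD _ _)); lra.
- exact: measurable_ge_norm.
- exact: measurable_ge_norm.
Unshelve. all: by end_near.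
Qed.

End InProbability.

Section SDE.
Context {R : realType} {d : measure_display} {T : measurableType d}.
Variables (P : probability T R) (F : R -> set (set T)) (W : R -> T -> R).
Hypotheses (hF : is_filtration F) (hW : is_brownian_motion P F W).
Variables (a c x : R).
Notation mu := (@lebesgue_measure R).
Notation X := (gbm W a c x).
Let b := a + c ^+ 2 / 2.

Lemma gbm_path_continuous w : continuous (fun s : R => X (Num.max s 0) w).
Proof.
have cW : continuous (fun s : R => W (Num.max s 0) w).
  apply: (@continuous_max0 _ (fun s => W s w)); exact: brownian_continuous hW w.
have cm : continuous (fun s : R => Num.max s 0).
  by move=> s; apply: continuous_max; [exact: cvg_id|exact: cvg_cst].
move=> s; rewrite /gbm; apply: cvgM; first exact: cvg_cst.
apply: continuous_comp; last exact: continuous_expR.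
apply: cvgD; apply: cvgM; try exact: cvg_cst.
- exact: cm.
- exact: cW.
Qed.

Lemma gbm_continuous_paths : continuous_paths X.
Proof.
move=> w; apply/subspace_continuousP => s; rewrite /= in_itv/= andbT => s0.
have := @gbm_path_continuous w s; rewrite /continuous_at max_l// => h.
apply: cvg_trans (cvg_within_filter _ h); apply: near_eq_cvg.
near=> y; rewrite max_l//.
have : `[0, +oo[%classic y by near: y; exact: withinT.
by rewrite /= in_itv/= andbT.
Unshelve. all: by end_near.
Qed.

Lemma gbm_riemann w (t : R) : 0 < t ->
  \sum_(k < N) X (k%:R * t / N%:R) w * (t / N%:R) @[N --> \oo] -->
  \int[mu]_(s in `[0, t]) X s w.
Proof.
move=> t0; have := riemann_sum_cvg (@gbm_path_continuous w) t0.
rewrite (_ : \int[mu]_(s in _) X (Num.max s 0) w = \int[mu]_(s in `[0, t]) X s w).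
  apply: cvg_trans; apply: near_eq_cvg; near=> N; apply: eq_bigr => k _.
  by rewrite max_l// divr_ge0// mulr_ge0// ltW.
apply: eq_Rintegral => s; rewrite inE/= in_itv/= => /andP[s0 _].
by rewrite max_l.
Unshelve. all: by end_near.
Qed.

Lemma measurable_gbm_integral (t : R) : 0 < t ->
  measurable_fun setT (fun w => \int[mu]_(s in `[0, t]) X s w).
Proof.
move=> t0.
apply: (@measurable_fun_cvg _ _ _ setT
  (fun N w => \sum_(k < N) X (k%:R * t / N%:R) w * (t / N%:R))).
  move=> N; apply: measurable_sum => k; apply: measurable_funM => //.
  by apply: (gbm_measurable hF hW); rewrite divr_ge0// mulr_ge0// ltW.
by move=> w _; exact: gbm_riemann.
Qed.

(** On each step X grows by X (exp (a dt + c z) - 1), which is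
    X (c z + gbm_noise + (exp (b dt) - 1)). Summed over the grid this telescopes
    to X_t - x; the first terms form the Ito sum, the second ones [gbm_defect], and
    the last ones are a Riemann sum of X with weight (exp (b dt) - 1) / dt,
    which tends to b. *)
Lemma gbm_ito_decomposition (t : R) (N : nat) w : 0 < t -> (0 < N)%N ->
  ito_sum (fun s w => c * X s w) W t N w -
    (X t w - x - \int[mu]_(s in `[0, t]) (b * X s w)) =
  - gbm_defect W a c x (t / N%:R) N w +
  (b * \int[mu]_(s in `[0, t]) X s w -
   (expR (b * (t / N%:R)) - 1) / (t / N%:R) *
   \sum_(k < N) X (k%:R * t / N%:R) w * (t / N%:R)).
Proof.
move=> t0 N0.
have NR : 0 < N%:R :> R by rewrite ltr0n.
set dt := t / N%:R; have dt0 : 0 < dt by rewrite divr_gt0.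
have -> : \int[mu]_(s in `[0, t]) (b * X s w) = b * \int[mu]_(s in `[0, t]) X s w.
  rewrite RintegralZl//.
  apply: (@eq_integrable _ _ _ mu _ _ (EFin \o (fun s : R => X (Num.max s 0) w))) => //.
    by move=> s; rewrite inE/= in_itv/= => /andP[s0 _]; rewrite max_l.
  apply: continuous_compact_integrable; first exact: segment_compact.
  by apply: continuous_subspaceT; exact: gbm_path_continuous.
have gridE (k : nat) : k%:R * t / N%:R = k%:R * dt by rewrite /dt mulrA.
have tE : t = N%:R * dt by rewrite /dt mulrC divfK// gt_eqF.
have tele : X t w - x = \sum_(k < N) (X (k.+1%:R * dt) w - X (k%:R * dt) w).
  rewrite -(big_mkord xpredT (fun k => X (k.+1%:R * dt) w - X (k%:R * dt) w)).
  rewrite telescope_sumr// -tE mul0r; congr (_ - _).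
  by rewrite /gbm (brownian_start hW) !mulr0 addr0 expR0 mulr1.
rewrite tele /ito_sum /gbm_defect.
under eq_bigr do rewrite !gridE.
under [X in _ = _ + (_ - _ * X)]eq_bigr do rewrite !gridE.
rewrite opprB addrCA; rewrite [RHS]addrCA; congr (_ + _).
rewrite mulr_sumr -!sumrN -!big_split/=; apply: eq_bigr => k _.
have step : X (k.+1%:R * dt) w = X (k%:R * dt) w *
    expR (a * dt + c * (W (k.+1%:R * dt) w - W (k%:R * dt) w)).
  rewrite /gbm -mulrA -expRD; congr (_ * expR _).
  by rewrite -addn1 natrD; ring.
rewrite step /gbm_noise -/b; field; exact: lt0r_neq0.
Qed.

(** There are N steps, each of variance of order (t / N) ^ 2. *)
Lemma gbm_defect_in_probability (t : R) : 0 < t -> forall e : R, 0 < e ->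
  P [set w | e <= `|- gbm_defect W a c x (t / N%:R) N w|] @[N --> \oo] --> 0%E.
Proof.
move=> t0 e e0.
have [C C0 HC] := gbm_noise_variance a c.
pose M := x ^+ 2 * expR (`|2 * a + 2 * c ^+ 2| * t).
pose K := e ^- 2 * (M * C * t ^+ 2).
have cK : (fun N : nat => (K / N%:R)%:E) @ \oo --> 0%E.
  apply: cvg_EFin; first exact: nearW.
  rewrite -[X in _ --> X](mulr0 K); apply: cvgM; first exact: cvg_cst.
  by rewrite -cvg_shiftS; exact: cvg_harmonic.
apply: (squeeze_cvge _ (@cvg_cst _ _ _ _ _) cK); near=> N.
have N0 : (0 < N)%N by near: N; exact: nbhs_infty_gt.
have NR : 0 < N%:R :> R by rewrite ltr0n.
set dt := t / N%:R; have dt0 : 0 < dt by rewrite divr_gt0.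
have dt1 : dt <= 1.
  rewrite /dt ler_pdivrMr// mul1r; near: N; exact: nbhs_infty_ger.
have tE : t = N%:R * dt by rewrite /dt mulrC divfK// gt_eqF.
have HCdt := HC dt dt0 dt1.
pose v := fine (\int[normal_prob 0 (Num.sqrt dt)]_z (gbm_noise a c dt z ^+ 2)%:E)%E.
have hv : (\int[normal_prob 0 (Num.sqrt dt)]_z (gbm_noise a c dt z ^+ 2)%:E = v%:E)%E.
  rewrite /v fineK// ge0_fin_numE ?(le_lt_trans HCdt) ?ltry//.
  by apply: integral_ge0 => z _; rewrite lee_fin sqr_ge0.
have vC : v <= C * dt ^+ 2 by rewrite -lee_fin -hv.
have hM (k : nat) : (k < N)%N -> x ^+ 2 * expR ((2 * a + 2 * c ^+ 2) * (k%:R * dt)) <= M.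
  move=> kN; rewrite /M ler_wpM2l ?sqr_ge0// ler_expR.
  apply: (@le_trans _ _ (`|2 * a + 2 * c ^+ 2| * (k%:R * dt))).
    by rewrite ler_wpM2r ?ler_norm// mulr_ge0// ltW.
  by rewrite ler_wpM2l// tE ler_pM2r// ler_nat ltnW.
have bound := gbm_defect_bound hF hW dt0 hv hM.
have mS : measurable_fun setT (fun w => - gbm_defect W a c x dt N w).
  apply: measurable_funN; apply: (past_measurable hF (s := N%:R * dt)).
    by rewrite mulr_ge0// ltW.
  exact: (gbm_defect_past hF hW).
have := second_moment_in_probability P e0 mS.
under eq_integral do rewrite sqrrN.
move=> /le_trans/(_ bound) bnd.
rewrite measure_ge0/=.
have M0 : 0 <= M by rewrite mulr_ge0 ?sqr_ge0 ?expR_ge0.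
have e20 : 0 < e ^+ 2 by rewrite exprn_gt0.
rewrite -(@lee_pmul2l _ (e ^+ 2)%:E) ?lte_fin//.
apply: (le_trans bnd); rewrite -EFinM lee_fin.
have -> : e ^+ 2 * (K / N%:R) = N%:R * (M * (C * dt ^+ 2)).
  by rewrite /K /dt; field; rewrite !lt0r_neq0.
by rewrite ler_wpM2l// ler_wpM2l.
Unshelve. all: by end_near.
Qed.

Lemma expR_quotient_cvg (t : R) : 0 < t ->
  (expR (b * (t / N%:R)) - 1) / (t / N%:R) @[N --> \oo] --> b.
Proof.
move=> t0.
have b1 : 0 <= b ^+ 2 * expR `|b| by rewrite mulr_ge0 ?sqr_ge0 ?expR_ge0.
apply/cvgrPdist_le => e e0; near=> N.
have N0 : (0 < N)%N by near: N; exact: nbhs_infty_gt.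
have NR : 0 < N%:R :> R by rewrite ltr0n.
set dt := t / N%:R; have dt0 : 0 < dt by rewrite divr_gt0.
have dt1 : dt <= 1.
  rewrite /dt ler_pdivrMr// mul1r; near: N; exact: nbhs_infty_ger.
have dte : b ^+ 2 * expR `|b| * dt <= e.
  rewrite /dt mulrA ler_pdivrMr// [e * _]mulrC -ler_pdivrMr//; near: N; exact: nbhs_infty_ger.
apply: le_trans dte.
have -> : b - (expR (b * dt) - 1) / dt = - ((expR (b * dt) - 1 - b * dt) / dt).
  by field; exact: lt0r_neq0.
rewrite normrN normrM (gtr0_norm (x := dt^-1)) ?invr_gt0// ler_pdivrMr//.
apply: (le_trans (expR_taylor1 _)).
rewrite exprMn; apply: (@le_trans _ _ (b ^+ 2 * dt ^+ 2 * expR `|b|)).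
  rewrite ler_wpM2l//; first by rewrite mulr_ge0// sqr_ge0.
  rewrite ler_expR normrM ler_piMr//.
  by rewrite ger0_norm// ltW.
by rewrite le_eqVlt; apply/orP; left; apply/eqP; ring.
Unshelve. all: by end_near.
Qed.

(** In the decomposition the noise part vanishes in second moment and the
    remaining part vanishes path by path. *)
Lemma gbm_ito (t : R) : 0 <= t -> is_ito_integral P (fun s w => c * X s w) W t
  (fun w => X t w - x - \int[mu]_(s in `[0, t]) (b * X s w)).
Proof.
rewrite le_eqVlt => /predU1P[<-|t0] e e0.
  apply: cvg_near_cst; near=> N.
  rewrite [X in P X](_ : _ = set0) ?measure0//; apply/seteqP; split => // w /=.
  rewrite set_itv1 Rintegral_set1 /ito_sum big1 => [|k _]; last first.
    by rewrite !mulr0 !mul0r subrr mulr0.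
  by rewrite /gbm (brownian_start hW) !mulr0 addr0 expR0 mulr1 !subrr normr0 leNgt e0.
have tN0 (N : nat) : 0 <= t / N%:R by rewrite divr_ge0// ltW.
apply: (@cvg_in_probabilityD _ _ _ P
  (fun N w => - gbm_defect W a c x (t / N%:R) N w)
  (fun N w => b * \int[mu]_(s in `[0, t]) X s w -
     (expR (b * (t / N%:R)) - 1) / (t / N%:R) *
     \sum_(k < N) X (k%:R * t / N%:R) w * (t / N%:R))) e0.
- move=> N; apply: measurable_funN; apply: measurable_sum => k.
  apply: measurable_funM.
    by apply: (gbm_measurable hF hW); rewrite mulr_ge0.
  apply: (measurableT_comp (measurable_gbm_noise a c _)).
  by apply: measurable_funB; apply: (brownian_measurable hF hW); rewrite mulr_ge0.
- move=> N; apply: measurable_funB.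
    by apply: measurable_funM => //; exact: measurable_gbm_integral.
  apply: measurable_funM => //; apply: measurable_sum => k; apply: measurable_funM => //.
  by apply: (gbm_measurable hF hW); rewrite divr_ge0// mulr_ge0// ltW.
- near=> N => w; apply: gbm_ito_decomposition => //.
  by near: N; exact: nbhs_infty_gt.
- exact: gbm_defect_in_probability.
move=> e' e'0; apply: pointwise_cvg_in_probability => //.
  move=> N; apply: measurable_funB.
    by apply: measurable_funM => //; exact: measurable_gbm_integral.
  apply: measurable_funM => //; apply: measurable_sum => k; apply: measurable_funM => //.
  by apply: (gbm_measurable hF hW); rewrite divr_ge0// mulr_ge0// ltW.
move=> w; rewrite -[X in _ --> X](subrr (b * \int[mu]_(s in `[0, t]) X s w)).
apply: cvgB; first exact: cvg_cst.
by apply: cvgM; [exact: expR_quotient_cvg|exact: gbm_riemann].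
Unshelve. all: by end_near.
Qed.

End SDE.

(** The drift of the logarithm is b minus half the squared volatility, and
    (sqrt 2 sigma) ^ 2 / 2 = sigma ^ 2. *)
Lemma gbm_solves_sde (R : realType) (d : measure_display) (T : measurableType d)
    (P : probability T R) (F : R -> set (set T)) (W : R -> T -> R)
    (b sigma x : R) :
  is_filtration F -> is_brownian_motion P F W -> 0 < x ->
  solves_sde P F W b sigma x (gbm W (b - sigma ^+ 2) (Num.sqrt 2 * sigma) x).
Proof.
move=> hF hW x0; split.
- by move=> w; rewrite /gbm (brownian_start hW) !mulr0 addr0 expR0 mulr1.
- by move=> t w _; rewrite mulr_gt0// expR_gt0.
- exact: (gbm_continuous_paths hW).
- move=> t t0 B mB.
  exact: (past_event hF t0 (gbm_past hF hW _ _ _ t0 (lexx t))).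
- move=> t t0; have := gbm_ito hF hW (b - sigma ^+ 2) (Num.sqrt 2 * sigma) x t0.
  rewrite (_ : b - sigma ^+ 2 + _ = b)//.
  by rewrite exprMn sqr_sqrtr//; field.
Qed.

(** * A lower bound for the discounted occupation density *)

Section Kernel.
Context {R : realType}.
Variables (a c r : R).
Hypotheses (c0 : 0 < c) (r0 : 0 < r).

(** The square root in the formula for the roots of c ^ 2 k ^ 2 / 2 + a k = r. *)
Definition root_disc : R := Num.sqrt (a ^+ 2 + 2 * c ^+ 2 * r).

Lemma root_disc_gt0 : 0 < root_disc.
Proof.
by rewrite sqrtr_gt0 ltr_wpDl ?sqr_ge0// mulr_gt0// mulr_gt0// exprn_gt0.
Qed.

Lemma sqr_root_disc : root_disc ^+ 2 = a ^+ 2 + 2 * c ^+ 2 * r.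
Proof.
by rewrite sqr_sqrtr// addr_ge0 ?sqr_ge0// mulr_ge0 ?(ltW r0)// mulr_ge0// sqr_ge0.
Qed.

(** The square root of the time t = |y| / root_disc that maximizes the exponent
    - r t - (y - a t) ^ 2 / (2 c ^ 2 t) of the discounted Gaussian density at y. *)
Definition sqrt_best_time (y : R) : R := Num.sqrt (`|y| / root_disc).

Definition kernel_const : R :=
  (Num.sqrt (pi *+ 2))^-1 * expR (- (2 * root_disc ^+ 2 / c ^+ 2)).

Lemma kernel_const_gt0 : 0 < kernel_const.
Proof.
by rewrite mulr_gt0 ?expR_gt0// invr_gt0 sqrtr_gt0 pmulrn_lgt0// pi_gt0.
Qed.

(** Write u0 = sqrt_best_time y. The exponent at time t lies below its maximum
    (a y - |y| root_disc) / c ^ 2 by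
    root_disc ^ 2 (u0 ^ 2 - t) ^ 2 / (2 c ^ 2 t). When sqrt t is within 1 of u0 the
    quotient (u0 ^ 2 - t) ^ 2 / t is at most 4, so this loss is bounded; and the
    window of such times has length at least u0 + 1, which compensates the factor
    1 / sqrt t of the density. *)
Lemma kernel_lower_bound (t y : R) :
  sqrt_best_time y ^+ 2 < t <= (sqrt_best_time y + 1) ^+ 2 ->
  kernel_const * (sqrt_best_time y + 1)^-1 *
    expR ((a * y - `|y| * root_disc) / c ^+ 2) <=
  expR (- r * t) * normal_pdf 0 (Num.sqrt t) ((y - a * t) / c).
Proof.
move=> /andP[]; set u0 := sqrt_best_time y => u0t tu1.
have u00 : 0 <= u0 by exact: sqrtr_ge0.
have D0 := root_disc_gt0; have D2 := sqr_root_disc.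
have t0 : 0 < t by apply: le_lt_trans u0t; exact: sqr_ge0.
have yE : `|y| = root_disc * u0 ^+ 2.
  by rewrite /u0 sqr_sqrtr ?divr_ge0 ?(ltW D0)// mulrC divfK// gt_eqF.
have s0 : Num.sqrt t != 0 by rewrite gt_eqF// sqrtr_gt0.
rewrite normal_pdfE// /normal_peak /normal_fun subr0 sqr_sqrtr ?(ltW t0)//.
have pk : (Num.sqrt (pi *+ 2))^-1 * (u0 + 1)^-1 <= (Num.sqrt (t * pi *+ 2))^-1 :> R.
  rewrite -mulrnAr sqrtrM ?(ltW t0)// invfM mulrC ler_wpM2r//.
  have u1 : 0 < u0 + 1 by lra.
  rewrite lef_pV2 ?posrE ?sqrtr_gt0//.
  by rewrite -(ger0_norm (ltW u1)) -sqrtr_sqr ler_wsqrtr.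
have sq : (u0 ^+ 2 - t) ^+ 2 <= 4 * t.
  set u := Num.sqrt t; have u_gt : 0 < u by rewrite sqrtr_gt0.
  have tE : t = u ^+ 2 by rewrite sqr_sqrtr// ltW.
  have uu0 : u0 <= u.
    by rewrite -(@ler_pXn2r _ 2)// ?nnegrE ?(ltW u_gt)// -tE ltW.
  have uu1 : u <= u0 + 1.
    by rewrite -(@ler_pXn2r _ 2)// ?nnegrE ?(ltW u_gt) -?tE//; lra.
  rewrite tE (_ : 4 * u ^+ 2 = (2 * u) ^+ 2); last by ring.
  rewrite -[leLHS]sqrrN opprB lerXn2r ?nnegrE//.
  - by rewrite subr_ge0 lerXn2r// nnegrE// ltW.
  - by rewrite mulr_ge0// ltW.
  rewrite subr_sqr; apply: (@le_trans _ _ (1 * (u + u0))).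
    by rewrite ler_wpM2r// ?addr_ge0 ?(ltW u_gt)//; lra.
  lra.
have ex : - (2 * root_disc ^+ 2 / c ^+ 2) + (a * y - `|y| * root_disc) / c ^+ 2 <=
   - r * t + - ((y - a * t) / c) ^+ 2 / (t *+ 2).
  have y2 : y ^+ 2 = root_disc ^+ 2 * u0 ^+ 4.
    by rewrite -(real_normK (num_real y)) yE; ring.
  rewrite -subr_ge0.
  have -> : - r * t + - ((y - a * t) / c) ^+ 2 / (t *+ 2) -
     (- (2 * root_disc ^+ 2 / c ^+ 2) + (a * y - `|y| * root_disc) / c ^+ 2) =
     root_disc ^+ 2 * (4 * t - (u0 ^+ 2 - t) ^+ 2) / (2 * c ^+ 2 * t).
    have E : y ^+ 2 - 2 * a * y * t + a ^+ 2 * t ^+ 2 = (y - a * t) ^+ 2 by ring.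
    rewrite yE exprMn -E y2.
    have rE : r = (root_disc ^+ 2 - a ^+ 2) / (2 * c ^+ 2).
      by rewrite D2; field; exact: lt0r_neq0.
    by rewrite rE; field; rewrite !lt0r_neq0.
  rewrite divr_ge0//; first by rewrite mulr_ge0 ?sqr_ge0// subr_ge0.
  by rewrite mulr_ge0 ?(ltW t0)// mulr_ge0// sqr_ge0.
rewrite [leRHS]mulrCA -expRD.
have -> : kernel_const / (u0 + 1) * expR ((a * y - `|y| * root_disc) / c ^+ 2) =
    (Num.sqrt (pi *+ 2))^-1 / (u0 + 1) *
    expR (- (2 * root_disc ^+ 2 / c ^+ 2) + (a * y - `|y| * root_disc) / c ^+ 2).
  by rewrite expRD /kernel_const mulrACA mulrA; ring.
apply: ler_pM; rewrite ?expR_ge0 ?ler_expR//.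
by rewrite mulr_ge0// invr_ge0 ?sqrtr_ge0// addr_ge0.
Qed.

End Kernel.

Section JointMeasurability.
Context {R : realType} {d : measure_display} {T : measurableType d}.
Notation MR := (measurableTypeR R).

Lemma measurable_countable_choice d1 d2 (U : measurableType d1) (V : measurableType d2)
    (f : nat -> U -> R) (k : V -> nat) :
  (forall n, measurable_fun setT (f n)) ->
  (forall n, measurable (k @^-1` [set n])) ->
  measurable_fun setT (fun p : U * V => f (k p.2) p.1).
Proof.
move=> mf mk _ B mB; rewrite setTI.
rewrite (_ : _ @^-1` B = \bigcup_n ((f n @^-1` B) `*` (k @^-1` [set n]))).
  apply: bigcup_measurable => n _; apply: measurableX => //.
  by rewrite -[X in measurable X]setTI; exact: mf.
apply/seteqP; split => [[u v]/= Buv|[u v]/= [n _ [/= Bu kv]]].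
  by exists (k v).
by rewrite kv.
Qed.

Lemma measurable_truncn (N : R) n : 0 <= N ->
  measurable ((fun t : MR => Num.truncn (N * Num.max t 0)) @^-1` [set n]).
Proof.
move=> N0; apply: is_interval_measurable => u v /= un vn t /andP[ut tv].
apply/eqP; rewrite eqn_leq -{1}vn -un; apply/andP; split; apply: le_truncn.
  by rewrite ler_wpM2l// ge_max !le_max tv lexx orbT.
by rewrite ler_wpM2l// ge_max !le_max ut lexx orbT.
Qed.

(** A process with continuous paths is the limit of its values at the last
    preceding multiple of 1 / (N + 1), and these approximations involve only
    countably many times. *)
Lemma measurable_continuous_process (W : R -> T -> R) :
  (forall t, 0 <= t -> measurable_fun setT (W t)) ->
  (forall w, continuous (fun s : R => W (Num.max s 0) w)) ->
  measurable_fun setT (fun p : T * MR => W (Num.max p.2 0) p.1).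
Proof.
move=> mW cW.
pose k (N : nat) (t : MR) : nat := Num.truncn (N.+1%:R * Num.max t 0).
apply: (@measurable_fun_cvg _ _ _ setT
  (fun N (p : T * MR) => W ((k N p.2)%:R / N.+1%:R) p.1)).
  move=> N; apply: (@measurable_countable_choice _ _ _ _ (fun j => W (j%:R / N.+1%:R)) (k N)).
  - by move=> j; apply: mW; rewrite divr_ge0.
  - by move=> j; exact: measurable_truncn.
move=> [w t] _ /=.
have s0 : 0 <= Num.max t 0 by rewrite le_max lexx orbT.
have ck : (k N t)%:R / N.+1%:R @[N --> \oo] --> Num.max t 0.
  apply/cvgrPdist_le => e e0; near=> N.
  have N0 : 0 < N.+1%:R :> R by [].
  have [q [qE [h1 h2]]] : exists q : R, (k N t)%:R = q /\
      q <= N.+1%:R * Num.max t 0 /\ N.+1%:R * Num.max t 0 < q + 1.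
    exists (k N t)%:R; split=> //; rewrite natr1.
    by have /andP[] := truncn_itv (mulr_ge0 (ltW N0) s0).
  rewrite qE; clear qE; move: (Num.max t 0) h1 h2 => z h1 h2.
  set M := N.+1%:R in N0 h1 h2 *.
  have Me : 1 <= e * M.
    rewrite mulrC -ler_pdivrMr// div1r (@le_trans _ _ N%:R)//; last by rewrite ler_nat.
    near: N; exact: nbhs_infty_ger.
  have -> : z - q / M = (M * z - q) / M by field; exact: lt0r_neq0.
  rewrite normrM (@gtr0_norm _ M^-1) ?invr_gt0// ler_pdivrMr//.
  by rewrite ger0_norm; lra.
have := cvg_comp _ _ ck (cW w (Num.max t 0)).
rewrite max_l//; apply: cvg_trans; apply: near_eq_cvg; near=> N => /=.
by rewrite max_l// divr_ge0.
Unshelve. all: by end_near.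
Qed.
End JointMeasurability.

Section Occupation.
Context {R : realType} {d : measure_display} {T : measurableType d}.
Variables (P : probability T R) (F : R -> set (set T)) (W : R -> T -> R).
Hypotheses (hF : is_filtration F) (hW : is_brownian_motion P F W).
Variables (a c r : R).
Hypotheses (c0 : c != 0) (r0 : 0 < r).
Notation MR := (measurableTypeR R).
Notation mu := (@lebesgue_measure R).
Notation X := (gbm W a c 1).
Variable H : R -> R.
Hypotheses (mH : measurable_fun setT H) (H0 : forall s, 0 <= H s).

Let c1 : 0 < `|c|. Proof. by rewrite normr_gt0. Qed.

(** Up to a constant factor this is s ^ (- m - 1) below 1 and s ^ (- n - 1)
    above 1, with m < 0 < n the roots of c ^ 2 k ^ 2 / 2 + a k = r; the exact
    occupation density of the process started at 1 has this shape too. *)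
Definition occupation_minorant (s : R) : R :=
  kernel_const a `|c| r * expR ((a * ln s - `|ln s| * root_disc a `|c| r) / `|c| ^+ 2)
  * inv_pos `|c| s.

Lemma occupation_minorant_ge0 s : 0 <= occupation_minorant s.
Proof.
by rewrite mulr_ge0 ?inv_pos_ge0// mulr_ge0 ?expR_ge0// ltW// kernel_const_gt0.
Qed.

Lemma measurable_occupation_minorant : measurable_fun setT occupation_minorant.
Proof.
have ml := @measurable_ln R.
apply: measurable_funM; last exact: measurable_inv_pos.
apply: measurable_funM => //; apply: measurableT_comp; first exact: measurable_expR.
apply: measurable_funM => //; apply: measurable_funB; apply: measurable_funM => //.
exact: measurableT_comp.
Qed.

Lemma gbm_law_density (t : R) : 0 < t ->
  (\int[mu]_s ((expR (- r * t) * normal_pdf 0 (Num.sqrt t) ((ln s - a * t) / `|c|) *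
     inv_pos `|c| s * H s)%:E) =
   \int[P]_w ((expR (- r * t) * H (X t w))%:E))%E.
Proof.
move=> t0.
have s0 : Num.sqrt t != 0 by rewrite gt_eqF// sqrtr_gt0.
have mX (k : R) : measurable_fun setT (fun z : R => expR (a * t + k * z)).
  apply: measurableT_comp; first exact: measurable_expR.
  by apply: measurable_funD => //; exact: measurable_funM.
have mHX (k : R) : measurable_fun setT
    (fun z : R => (expR (- r * t) * H (expR (a * t + k * z)))%:E).
  by apply/measurable_EFinP; apply: measurable_funM => //; exact: measurableT_comp.
have HX0 (k z : R) : (0 <= (expR (- r * t) * H (expR (a * t + k * z)))%:E)%E.
  by rewrite lee_fin mulr_ge0 ?expR_ge0.
have mpdf : measurable_fun setT (fun z : R => (normal_pdf 0 (Num.sqrt t) z)%:E).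
  by apply/measurable_EFinP; exact: measurable_normal_pdf.
pose f (s : R) : \bar R :=
  (expR (- r * t) * normal_pdf 0 (Num.sqrt t) ((ln s - a * t) / `|c|) * H s)%:E.
have mf : measurable_fun setT f.
  apply/measurable_EFinP; apply: measurable_funM => //; apply: measurable_funM => //.
  apply: measurableT_comp; first exact: measurable_normal_pdf.
  by apply: measurable_funM => //; apply: measurable_funB => //; exact: measurable_ln.
have f0 s : (0 <= f s)%E.
  by rewrite lee_fin mulr_ge0 ?H0// mulr_ge0 ?expR_ge0 ?normal_pdf_ge0.
transitivity (\int[mu]_s (f s * (inv_pos `|c| s)%:E))%E.
  by apply: eq_integral => s _; rewrite /f -EFinM; congr EFin; ring.
rewrite -(integral_expR_affine (a * t) c1 mf f0).
transitivity (\int[mu]_z ((expR (- r * t) * H (expR (a * t + c * z)))%:E *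
    (normal_pdf 0 (Num.sqrt t) z)%:E))%E; last first.
  rewrite -ge0_integral_normal//.
  under [RHS]eq_integral do rewrite /gbm mul1r.
  by rewrite (brownian_integral hF hW t0 (mHX c) (HX0 c)).
transitivity (\int[mu]_z ((expR (- r * t) * H (expR (a * t + `|c| * z)))%:E *
    (normal_pdf 0 (Num.sqrt t) z)%:E))%E.
  apply: eq_integral => z _; rewrite /f expRK -EFinM; congr EFin.
  have -> : (a * t + `|c| * z - a * t) / `|c| = z by field; exact: lt0r_neq0.
  by ring.
(* reflecting z replaces c by its opposite *)
have [c_ge0|c_lt0] := leP 0 c; first by rewrite ger0_norm.
rewrite (ltr0_norm c_lt0).
rewrite ge0_integral_opp.
- by apply: eq_integral => z _; rewrite normal_pdfN// mulrNN.
- by apply: emeasurable_funM.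
- by move=> z; rewrite mule_ge0// lee_fin normal_pdf_ge0.
Qed.

(** By Tonelli's theorem the right-hand side integrates H against the time
    integral of the discounted densities of X. Keeping, for each s, only the times
    in the window of [kernel_lower_bound] at y = ln s gives the left-hand side. *)
Lemma gbm_occupation_lower_bound :
  (\int[mu]_s (occupation_minorant s * H s)%:E <=
   \int[P]_w \int[mu]_(t in `[0%R, +oo[) (expR (- r * t) * H (X t w))%:E)%E.
Proof.
pose Phi (p : T * MR) : \bar R :=
  (\1_(`]0, +oo[) p.2 * (expR (- r * p.2) * H (X (Num.max p.2 0) p.1)))%:E.
have mXX : measurable_fun setT (fun p : T * MR => X (Num.max p.2 0) p.1).
  apply: measurable_continuous_process; first by move=> t; exact: (gbm_measurable hF hW).
  exact: (gbm_path_continuous hW).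
have mPhi : measurable_fun setT Phi.
  apply/measurable_EFinP; apply: measurable_funM.
    by apply: measurableT_comp => //; exact: measurable_indic.
  apply: measurable_funM; last exact: measurableT_comp.
  apply: measurableT_comp; first exact: measurable_expR.
  by apply: measurable_funM.
have Phi0 p : (0 <= Phi p)%E.
  by rewrite lee_fin mulr_ge0// mulr_ge0 ?expR_ge0.
have -> : (\int[P]_w \int[mu]_(t in `[0%R, +oo[) (expR (- r * t) * H (X t w))%:E =
  \int[P]_w \int[mu]_t Phi (w, t))%E.
  apply: eq_integral => w _.
  transitivity (\int[mu]_(t in `[0%R, +oo[) (expR (- r * t) * H (X (Num.max t 0) w))%:E)%E.
    apply: eq_integral => t; rewrite inE/= in_itv/= andbT => t0.
    by rewrite max_l.
  rewrite -integral_itv_obnd_cbnd; last first.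
    apply/measurable_EFinP; apply: measurable_funTS; apply: measurable_funM.
      apply: measurableT_comp; first exact: measurable_expR.
      exact: measurable_funM.
    by apply: measurableT_comp => //; exact: (measurable_fun_pair2 w mXX).
  rewrite integral_mkcond; apply: eq_integral => t _.
  by rewrite patchE /Phi/= indicE; case: ifP => _; rewrite ?mul1r ?mul0r.
rewrite fubini_tonelli//.
(* Lam keeps the times of the window ]A ^ 2, (A + 1) ^ 2] and gives them the
   height 1 / (A + 1), so that its time integral is at least the minorant *)
pose A (s : R) := sqrt_best_time a `|c| r (ln s).
pose Lam (p : MR * MR) : \bar R :=
  ((if (A p.2 ^+ 2 < p.1) && (p.1 <= (A p.2 + 1) ^+ 2) then
     (A p.2 + 1)^-1 else 0) * (occupation_minorant p.2 * H p.2))%:E.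
have mln : measurable_fun setT (fun p : MR * MR => ln p.2).
  exact: (measurableT_comp (@measurable_ln R)).
have mA : measurable_fun setT (fun p : MR * MR => A p.2).
  have msq : measurable_fun setT (@Num.sqrt R).
    by apply: continuous_measurable_fun; exact: sqrt_continuous.
  apply: (measurableT_comp msq).
  by apply: measurable_funM => //; exact: measurableT_comp.
have mRH : measurable_fun setT (fun s => occupation_minorant s * H s).
  by apply: measurable_funM => //; exact: measurable_occupation_minorant.
have A0 s : 0 <= A s by exact: sqrtr_ge0.
have mLam : measurable_fun setT Lam.
  apply/measurable_EFinP; apply: measurable_funM.
    2: exact: (measurableT_comp mRH measurable_snd).
  apply: measurable_fun_ifT => //.
    apply: measurable_and.
      by apply: measurable_fun_ltr => //; exact: measurable_funX.
    by apply: measurable_fun_ler => //; apply: measurable_funX; exact: measurable_funD.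
  rewrite (_ : (fun p => _) = (fun p : MR * MR => (A p.2 + 1) `^ (-1))).
    by apply: (measurableT_comp (measurable_powR _)); exact: measurable_funD.
  by apply/funext => p; rewrite powR_inv1// addr_ge0.
have Lam0 p : (0 <= Lam p)%E.
  rewrite lee_fin mulr_ge0//; last by rewrite mulr_ge0// occupation_minorant_ge0.
  by case: ifP => // _; rewrite invr_ge0 addr_ge0.
apply: (@le_trans _ _ (\int[mu]_t \int[mu]_s Lam (t, s))%E); last first.
  apply: ge0_le_integral => //.
  - by move=> t _; apply: integral_ge0.
  - exact: measurable_fun_fubini_tonelli_F.
  - exact: measurable_fun_fubini_tonelli_G.
  move=> t _; have [t0|t0] := leP t 0.
    rewrite integral0_eq; first by apply: integral_ge0.
    move=> s _; rewrite /Lam/= ifF ?mul0r//; apply/negbTE; rewrite negb_and -leNgt.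
    by rewrite (le_trans t0) ?sqr_ge0.
  have -> : (\int[P]_w Phi (w, t) = \int[P]_w (expR (- r * t) * H (X t w))%:E)%E.
    apply: eq_integral => w _; rewrite /Phi/= indicE mem_set ?mul1r ?max_l ?(ltW t0)//.
    by rewrite /= in_itv/= t0.
  rewrite -gbm_law_density//.
  have mq : measurable_fun setT (fun s : R => expR (- r * t) *
      normal_pdf 0 (Num.sqrt t) ((ln s - a * t) / `|c|)).
    apply: measurable_funM => //; apply: measurableT_comp; first exact: measurable_normal_pdf.
    by apply: measurable_funM => //; apply: measurable_funB => //; exact: measurable_ln.
  apply: ge0_le_integral => //.
  - exact: (measurable_fun_pair2 t mLam).
  - apply/measurable_EFinP; apply: measurable_funM => //; apply: measurable_funM => //.
    exact: measurable_inv_pos.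
  move=> s _; rewrite lee_fin mulrA ler_wpM2r//.
  case: ifPn => [tA|_]; last first.
    rewrite mul0r mulr_ge0 ?inv_pos_ge0//.
    by rewrite mulr_ge0 ?expR_ge0 ?normal_pdf_ge0.
  have := kernel_lower_bound c1 r0 tA; rewrite -/(A s) => klb.
  rewrite /occupation_minorant mulrA ler_wpM2r ?inv_pos_ge0//.
  by apply: le_trans klb; rewrite le_eqVlt; apply/orP; left; apply/eqP; ring.
rewrite fubini_tonelli//; apply: ge0_le_integral => //.
- by move=> s _; rewrite lee_fin mulr_ge0// occupation_minorant_ge0.
- exact/measurable_EFinP.
- exact: measurable_fun_fubini_tonelli_G.
move=> s _.
have u1 : 0 < A s + 1 by rewrite ltr_wpDl.
have RH0 : 0 <= occupation_minorant s * H s by rewrite mulr_ge0// occupation_minorant_ge0.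
have -> : (\int[mu]_t Lam (t, s) =
    \int[mu]_(t in `](A s ^+ 2)%R, ((A s + 1) ^+ 2)%R])
      ((A s + 1)^-1 * (occupation_minorant s * H s))%:E)%E.
  rewrite [RHS]integral_mkcond; apply: eq_integral => t _.
  rewrite patchE /Lam/= mem_setE in_itv/=.
  by case: ifP => _; rewrite ?mul0r.
rewrite integral_cst//; have /= -> := lebesgue_measure_itv `](A s ^+ 2), ((A s + 1) ^+ 2)].
rewrite lte_fin ltrXn2r// ?ltrDl//= -EFinD -EFinM lee_fin.
have -> : (A s + 1) ^+ 2 - A s ^+ 2 = 2 * A s + 1 by ring.
rewrite [leRHS]mulrAC ler_peMl// mulrC ler_pdivlMr// mul1r.
by have := A0 s; lra.
Qed.
End Occupation.

(** * Integrability of the payoff against the two powers *)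

Section Integrability.
Context {R : realType}.
Notation mu := (@lebesgue_measure R).
Variables (b sigma r : R).
Hypotheses (sigma0 : sigma != 0) (r0 : 0 < r).
Variable h : R -> R.
Hypothesis h_incr : increasing_pos h.

Notation m := (exponent_m b sigma r).
Notation n := (exponent_n b sigma r).
Let a := b - sigma ^+ 2.
Let c := Num.sqrt 2 * sigma.
Let D := root_disc a `|c| r.

Lemma sqr_norm_vol : `|c| ^+ 2 = 2 * sigma ^+ 2.
Proof. by rewrite real_normK ?num_real// exprMn sqr_sqrtr. Qed.

Lemma vol_neq0 : c != 0.
Proof. by rewrite mulf_neq0// gt_eqF// sqrtr_gt0. Qed.

Lemma root_discE : D = Num.sqrt ((b - sigma ^+ 2) ^+ 2 + 4 * sigma ^+ 2 * r).
Proof. by rewrite /D /root_disc sqr_norm_vol /a; congr Num.sqrt; ring. Qed.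

Lemma exponent_mE : m = (- a - D) / `|c| ^+ 2.
Proof. by rewrite /exponent_m -root_discE sqr_norm_vol /a opprB. Qed.

Lemma exponent_nE : n = (- a + D) / `|c| ^+ 2.
Proof. by rewrite /exponent_n -root_discE sqr_norm_vol /a opprB. Qed.

(** A function measurable on the whole line that agrees with h on (0, oo),
    outside which h is arbitrary. *)
Definition pos_ext (s : R) : R := h (expR (ln s)).

Lemma pos_extE s : 0 < s -> pos_ext s = h s.
Proof. by move=> s0; rewrite /pos_ext lnK. Qed.

Lemma measurable_pos_ext : measurable_fun setT pos_ext.
Proof.
have mhe : measurable_fun setT (h \o expR).
  apply: nondecreasing_measurable => // u v uv /=.
  by apply: h_incr; rewrite ?expR_gt0// ler_expR.
exact: (measurableT_comp mhe (@measurable_ln R)).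
Qed.

Lemma measurable_power_pos (k : R) (A : set R) : A `<=` `]0, +oo[ ->
  measurable A -> measurable_fun A (fun s => s `^ k * h s).
Proof.
move=> A0 mA; apply: (@eq_measurable_fun _ _ _ _ _ (fun s => s `^ k * pos_ext s)).
  by move=> s; rewrite inE => /A0/=; rewrite in_itv/= andbT => s0; rewrite pos_extE.
apply: measurable_funTS; apply: measurable_funM; first exact: measurable_powR.
exact: measurable_pos_ext.
Qed.

Section dominated_by_minorant.
Hypothesis occ : (\int[mu]_s (occupation_minorant a c r s * `|pos_ext s|)%:E < +oo)%E.

Lemma integrable_power_dominated (k L : R) (A : set R) : A `<=` `]0, +oo[ ->
  measurable A ->
  (forall s, A s -> k * ln s <= L + (a * ln s - `|ln s| * D) / `|c| ^+ 2) ->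
  mu.-integrable A (fun s => (s `^ (k - 1) * h s)%:E).
Proof.
move=> A0 mA H.
have c0 : 0 < `|c| by rewrite normr_gt0 vol_neq0.
have kc := kernel_const_gt0 a `|c| r.
pose C := expR L * `|c| / kernel_const a `|c| r.
have iocc : mu.-integrable A (fun s => (C * (occupation_minorant a c r s * `|pos_ext s|))%:E).
  have mo : measurable_fun setT (fun s => occupation_minorant a c r s * `|pos_ext s|).
    apply: measurable_funM; first exact: measurable_occupation_minorant.
    by apply: measurableT_comp => //; exact: measurable_pos_ext.
  have io : mu.-integrable setT (fun s => (occupation_minorant a c r s * `|pos_ext s|)%:E).
    apply/integrableP; split; first exact/measurable_EFinP.
    under eq_integral => s _.
      rewrite gee0_abs ?lee_fin; last first.
        by rewrite mulr_ge0// occupation_minorant_ge0 ?vol_neq0.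
      over.
    exact: occ.
  apply: (@integrableS _ _ _ mu setT) => //.
  exact: (integrableZl measurableT C io).
apply: le_integrable iocc => //.
  by apply/measurable_EFinP; exact: measurable_power_pos.
move=> s As; have s0 : 0 < s by have := A0 _ As; rewrite /= in_itv/= andbT.
have C0 : 0 <= C by rewrite divr_ge0 ?(ltW kc)// mulr_ge0 ?expR_ge0.
have rd0 : 0 <= occupation_minorant a c r s by rewrite occupation_minorant_ge0 ?vol_neq0.
rewrite /= lee_fin pos_extE// (ger0_norm (x := C * _)); last by rewrite mulr_ge0// mulr_ge0.
rewrite normrM (ger0_norm (powR_ge0 _ _)) [leRHS]mulrA ler_wpM2r//.
rewrite /occupation_minorant inv_posE// -/D.
have -> : C * (kernel_const a `|c| r * expR ((a * ln s - `|ln s| * D) / `|c| ^+ 2) *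
    (`|c| * s)^-1) = expR L * expR ((a * ln s - `|ln s| * D) / `|c| ^+ 2) * s^-1.
  by rewrite /C; field; rewrite !lt0r_neq0.
rewrite -[X in _ <= _ * X^-1](lnK s0) -expRN -!expRD /powR gt_eqF// ler_expR.
by have := H _ As; lra.
Qed.

(** On ]0, x[ the weight s ^ (- m - 1) exceeds a multiple of the minorant only
    between 1 and x, where both are bounded; the constant
    exp (2 D |ln x| / c ^ 2) accounts for that range. *)
Lemma integrable_power_m (x : R) : 0 < x ->
  mu.-integrable `]0, x[ (fun s => (s `^ (- m - 1) * h s)%:E).
Proof.
move=> x0.
have D0 : 0 <= D by exact: sqrtr_ge0.
have c2 : 0 < `|c| ^+ 2 by rewrite exprn_gt0// normr_gt0 vol_neq0.
apply: (@integrable_power_dominated _ (2 * D * `|ln x| / `|c| ^+ 2)) => //.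
  by move=> s /=; rewrite !in_itv/= => /andP[->].
move=> s /=; rewrite in_itv/= => /andP[s0 sx].
rewrite -subr_ge0 exponent_mE.
have -> : 2 * D * `|ln x| / `|c| ^+ 2 + (a * ln s - `|ln s| * D) / `|c| ^+ 2 -
   - ((- a - D) / `|c| ^+ 2) * ln s = D * (2 * `|ln x| - `|ln s| - ln s) / `|c| ^+ 2.
  by field; rewrite normr_eq0 vol_neq0.
rewrite divr_ge0// ?(ltW c2)// mulr_ge0//.
have lnsx : ln s <= ln x by rewrite ler_ln// ?posrE// ltW.
have := ler_norm (ln x); have := normr_ge0 (ln x).
by have [l0|l0] := leP 0 (ln s); [rewrite (ger0_norm l0)|rewrite (ltr0_norm l0)]; lra.
Qed.

Lemma integrable_power_n (x : R) : 0 < x ->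
  mu.-integrable `]x, +oo[ (fun s => (s `^ (- n - 1) * h s)%:E).
Proof.
move=> x0.
have D0 : 0 <= D by exact: sqrtr_ge0.
have c2 : 0 < `|c| ^+ 2 by rewrite exprn_gt0// normr_gt0 vol_neq0.
apply: (@integrable_power_dominated _ (2 * D * `|ln x| / `|c| ^+ 2)) => //.
  by move=> s /=; rewrite !in_itv/= !andbT; exact: lt_trans.
move=> s /=; rewrite in_itv/= andbT => xs.
have s0 : 0 < s by exact: lt_trans xs.
rewrite -subr_ge0 exponent_nE.
have -> : 2 * D * `|ln x| / `|c| ^+ 2 + (a * ln s - `|ln s| * D) / `|c| ^+ 2 -
   - ((- a + D) / `|c| ^+ 2) * ln s = D * (2 * `|ln x| - `|ln s| + ln s) / `|c| ^+ 2.
  by field; rewrite normr_eq0 vol_neq0.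
rewrite divr_ge0// ?(ltW c2)// mulr_ge0//.
have lnsx : ln x <= ln s by rewrite ler_ln// ?posrE// ltW.
have := ler_norm (- ln x); rewrite normrN; have := normr_ge0 (ln x).
by have [l0|l0] := leP 0 (ln s); [rewrite (ger0_norm l0)|rewrite (ltr0_norm l0)]; lra.
Qed.
End dominated_by_minorant.

End Integrability.

Lemma occupation_minorant_integral_lty (R : realType) (d : measure_display)
    (T : measurableType d) (P : probability T R) (F : R -> set (set T))
    (W : R -> T -> R) (b sigma r : R) (h : R -> R) :
  is_filtration F -> is_brownian_motion P F W -> sigma != 0 -> 0 < r ->
  increasing_pos h ->
  (expected_discounted_abs P r h
     (gbm W (b - sigma ^+ 2) (Num.sqrt 2 * sigma) 1) < +oo)%E ->
  (\int[lebesgue_measure]_s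
    (occupation_minorant (b - sigma ^+ 2) (Num.sqrt 2 * sigma) r s * `|pos_ext h s|)%:E
   < +oo)%E.
Proof.
move=> hF hW sigma0 r0 h_incr; apply: le_lt_trans.
have mH : measurable_fun setT (fun s => `|pos_ext h s|).
  by apply: measurableT_comp => //; exact: measurable_pos_ext.
have := @gbm_occupation_lower_bound _ _ _ P F W hF hW (b - sigma ^+ 2)
  (Num.sqrt 2 * sigma) r (vol_neq0 sigma0) r0 _ mH (fun s => normr_ge0 _).
move=> /le_trans; apply.
rewrite le_eqVlt; apply/orP; left; apply/eqP.
apply: eq_integral => w _; apply: eq_integral => t _.
by rewrite pos_extE// /gbm mul1r expR_gt0.
Qed.

(** * Integrals of powers *)

Section PowerIntegrals.
Context {R : realType}.
Notation mu := (@lebesgue_measure R).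

Lemma powR_continuous (k x : R) : 0 < x -> {for x, continuous (fun s : R => s `^ k)}.
Proof.
move=> x0; apply/differentiable_continuous/derivable1_diffP.
by have := is_derive1_powR k x0; case.
Qed.

Lemma powR_subr1 (k s : R) : 0 < s -> s `^ (k - 1) = s `^ k / s.
Proof.
by move=> s0; rewrite powRB ?powRr1 ?ltW// (gt_eqF s0) implybT.
Qed.

Lemma powR_neq0 (k x : R) : 0 < x -> x `^ k != 0.
Proof. by move=> x0; rewrite gt_eqF// powR_gt0. Qed.

Lemma integral_powR_oc (k p q : R) : k != 0 -> 0 < p -> p <= q ->
  (\int[mu]_(s in `]p, q]) (s `^ (k - 1))%:E = ((q `^ k - p `^ k) / k)%:E)%E.
Proof.
move=> k0 p0 pq.
have sp s : p <= s <= q -> 0 < s by move=> /andP[+ _]; exact: lt_le_trans.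
have dF s : p <= s <= q -> is_derive s 1 (fun s => k^-1 * s `^ k) (s `^ (k - 1)).
  move=> /sp s0.
  have := @is_deriveZ _ _ _ (fun s : R => s `^ k) k^-1 s 1 _ (is_derive1_powR k s0).
  by move=> dk; apply: is_derive_eq; rewrite [LHS]mulrA mulVf// mul1r.
have cf s : p <= s <= q -> {for s, continuous (fun s : R => s `^ (k - 1))}.
  by move=> /sp; exact: powR_continuous.
by rewrite (integral_itv_oc_derive pq dF cf) -mulrBr mulrC.
Qed.

Lemma measurable_powR_EFin (k : R) (A : set R) :
  measurable_fun A (fun s => (s `^ k)%:E).
Proof. by apply/measurable_EFinP; apply: measurable_funTS; exact: measurable_powR. Qed.

Lemma powR_harmonic_cvg (k x : R) : 0 < k -> 0 < x ->
  (x * i.+1%:R^-1) `^ k @[i --> \oo] --> 0.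
Proof.
move=> k0 x0; have /cvg_at_rightP := @powR_cvg0 R k k0; apply; split.
  by move=> i; rewrite mulr_gt0// invr_gt0.
rewrite -[X in _ --> X](mulr0 x); apply: cvgM; first exact: cvg_cst.
exact: cvg_harmonic.
Qed.

Lemma integral_powR_0 (k x : R) : 0 < k -> 0 < x ->
  (\int[mu]_(s in `]0%R, x]) (s `^ (k - 1))%:E = (x `^ k / k)%:E)%E.
Proof.
move=> k0 x0.
pose S i := `]x * i.+1%:R^-1, x]%classic.
have nS : nondecreasing_seq S.
  move=> i j ij; apply/subsetPset => s; rewrite /S/= !in_itv/= => /andP[h ->].
  by rewrite andbT (le_lt_trans _ h)// ler_pM2l// lef_pV2 ?posrE// ler_nat.
have US : \bigcup_i S i = `]0, x]%classic.
  apply/seteqP; split => s /=.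
    move=> [i _]; rewrite /S/= !in_itv/= => /andP[h ->]; rewrite andbT.
    by apply: lt_trans h; rewrite mulr_gt0// invr_gt0.
  rewrite in_itv/= => /andP[s0 sx]; exists (Num.truncn (x / s)) => //.
  by rewrite /S/= in_itv/= sx andbT ltr_pdivrMr// [ltRHS]mulrC -ltr_pdivrMr// truncnS_gt.
have cvS : (\int[mu]_(x in S i) (x `^ (k - 1))%:E @[i --> \oo] -->
    \int[mu]_(x0 in `]0%R, x]) (x0 `^ (k - 1))%:E)%E.
  rewrite -US; apply: ge0_nondecreasing_set_cvg_integral => //.
  - by move=> i; exact: measurable_itv.
  - by move=> i; exact: measurable_powR_EFin.
  - by move=> i s _; rewrite lee_fin powR_ge0.
apply: (cvg_unique _ cvS) => //.
have -> : (fun i => \int[mu]_(x in S i) (x `^ (k - 1))%:E)%E =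
  (fun i => ((x `^ k - (x * i.+1%:R^-1) `^ k) / k)%:E).
  apply/funext => i; rewrite integral_powR_oc ?gt_eqF//.
    by rewrite mulr_gt0// invr_gt0.
  by rewrite ler_piMr ?(ltW x0)// invf_le1// ler1n.
apply: cvg_EFin; first exact: nearW.
apply: cvgM; last exact: cvg_cst.
rewrite -[X in _ --> X]subr0; apply: cvgB; first exact: cvg_cst.
exact: powR_harmonic_cvg.
Qed.

Lemma integral_powR_y (k x : R) : k < 0 -> 0 < x ->
  (\int[mu]_(s in `]x, +oo[) (s `^ (k - 1))%:E = (- (x `^ k) / k)%:E)%E.
Proof.
move=> k0 x0.
pose S i := `]x, x * i.+1%:R]%classic.
have nS : nondecreasing_seq S.
  move=> i j ij; apply/subsetPset => s; rewrite /S/= !in_itv/= => /andP[-> h] /=.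
  by rewrite (le_trans h)// ler_pM2l// ler_nat.
have US : \bigcup_i S i = `]x, +oo[%classic.
  apply/seteqP; split => s /=.
    by move=> [i _]; rewrite /S/= !in_itv/= => /andP[->].
  rewrite in_itv/= andbT => xs; exists (Num.truncn (s / x)) => //.
  rewrite /S/= in_itv/= xs/= mulrC -ler_pdivrMr//.
  by rewrite ltW// truncnS_gt.
have cvS : (\int[mu]_(x in S i) (x `^ (k - 1))%:E @[i --> \oo] -->
    \int[mu]_(x0 in `]x, +oo[) (x0 `^ (k - 1))%:E)%E.
  rewrite -US; apply: ge0_nondecreasing_set_cvg_integral => //.
  - by move=> i; exact: measurable_itv.
  - by move=> i; exact: measurable_powR_EFin.
  - by move=> i s _; rewrite lee_fin powR_ge0.
apply: (cvg_unique _ cvS) => //.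
have -> : (fun i => \int[mu]_(x in S i) (x `^ (k - 1))%:E)%E =
  (fun i => (((x^-1 * i.+1%:R^-1) `^ (- k) - x `^ k) / k)%:E).
  apply/funext => i; rewrite integral_powR_oc ?lt_eqF//.
    have xi0 : 0 <= x * i.+1%:R by rewrite mulr_ge0// ltW.
    by rewrite -invfM -(powR_inv1 xi0) -powRrM mulN1r opprK.
  by rewrite ler_peMr ?(ltW x0)// ler1n.
apply: cvg_EFin; first exact: nearW.
apply: cvgM; last exact: cvg_cst.
rewrite -[X in _ --> X]add0r; apply: cvgB; last exact: cvg_cst.
by apply: powR_harmonic_cvg; rewrite ?oppr_gt0 ?invr_gt0.
Qed.

Lemma integrable_powR_0 (k x : R) : 0 < k -> 0 < x ->
  mu.-integrable `]0, x] (fun s => (s `^ (k - 1))%:E).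
Proof.
move=> k0 x0; apply/integrableP; split; first exact: measurable_powR_EFin.
under eq_integral do rewrite gee0_abs ?lee_fin ?powR_ge0//.
by rewrite integral_powR_0// ltry.
Qed.

Lemma integrable_powR_y (k x : R) : k < 0 -> 0 < x ->
  mu.-integrable `]x, +oo[ (fun s => (s `^ (k - 1))%:E).
Proof.
move=> k0 x0; apply/integrableP; split; first exact: measurable_powR_EFin.
under eq_integral do rewrite gee0_abs ?lee_fin ?powR_ge0//.
by rewrite integral_powR_y// ltry.
Qed.

End PowerIntegrals.

(** * Differentiating the resolvent *)

Section DerivativeDomination.
Context {R : realType}.

(** Here f = O(g) and g = o(y - x). *)
Lemma is_derive_dominated0 (f g : R -> R) (x M : R) :
  is_derive x 1 g 0 -> g x = 0 -> f x = 0 ->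
  (\forall y \near x, `|f y| <= M * `|g y|) -> is_derive x 1 f 0.
Proof.
move=> [dg Dg] gx fx fg.
have M1 : 0 < `|M| + 1 by rewrite ltr_wpDl.
have cg : (fun e : R => e^-1 *: ((g \o shift x) (e *: 1) - g x)) @ 0^' --> 0.
  have /cvg_ex[l gl] := dg; suff l0 : l = 0 by move: gl; rewrite l0.
  by rewrite -Dg; apply/esym/cvg_lim.
have cf : (fun e : R => e^-1 *: ((f \o shift x) (e *: 1) - f x)) @ 0^' --> 0.
  apply/cvgrPdist_le => e e0.
  have /cvgrPdist_le/(_ (e / (`|M| + 1)))/(_ (divr_gt0 e0 M1)) cg' := cg.
  have nfg : \forall u \near 0^', `|f (u *: 1 + x)| <= M * `|g (u *: 1 + x)|.
    have shx : (fun u : R => u *: 1 + x) @ 0^' --> x.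
      rewrite -[X in _ --> X](add0r x); apply: cvgD; last exact: cvg_cst.
      rewrite -[X in _ --> X](scale0r (1 : R)); apply: cvgZ; last exact: cvg_cst.
      exact: cvg_within.
    exact: (shx _ fg).
  near=> u.
  have hu : `|f (u *: 1 + x)| <= M * `|g (u *: 1 + x)| by near: u.
  have : `|0 - u^-1 *: (g (u *: 1 + x) - g x)| <= e / (`|M| + 1) by near: u.
  rewrite gx fx !subr0 !sub0r !normrN !normrZ => hg.
  apply: (@le_trans _ _ ((`|M| + 1) * (`|u^-1| * `|g (u *: 1 + x)|))).
    rewrite mulrCA ler_wpM2l// (le_trans hu)// ler_wpM2r//.
    by rewrite (le_trans (ler_norm M))// lerDl.
  by rewrite mulrC -ler_pdivlMr.
split; first by apply/cvg_ex; exists 0.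
by apply/cvg_lim.
Unshelve. all: by end_near.
Qed.

End DerivativeDomination.

Section ResolventCalculus.
Context {R : realType}.
Notation mu := (@lebesgue_measure R).
Variables (m n : R) (h : R -> R).
Hypotheses (m0 : m < 0) (n0 : 0 < n) (h_incr : increasing_pos h).
Hypothesis IA : forall x, 0 < x ->
  mu.-integrable `]0, x[ (fun s => (s `^ (- m - 1) * h s)%:E).
Hypothesis IB : forall x, 0 < x ->
  mu.-integrable `]x, +oo[ (fun s => (s `^ (- n - 1) * h s)%:E).

Definition lower_part (x : R) : R := \int[mu]_(s in `]0, x[) (s `^ (- m - 1) * h s).
Definition upper_part (x : R) : R := \int[mu]_(s in `]x, +oo[) (s `^ (- n - 1) * h s).
Notation A := lower_part.
Notation B := upper_part.

Let Nm0 : 0 < - m. Proof. by rewrite oppr_gt0. Qed.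
Let Nn0 : - n < 0. Proof. by rewrite oppr_lt0. Qed.

Lemma IA_oc x y : 0 < x ->
  mu.-integrable `]x, y] (fun s => (s `^ (- m - 1) * h s)%:E).
Proof.
move=> x0; have y0 : 0 < Num.max y 0 + 1 by rewrite ltr_wpDl// le_max lexx orbT.
apply: integrableS (IA y0) => // s /=; rewrite !in_itv/= => /andP[xs sy].
by rewrite (lt_trans x0 xs)/= (le_lt_trans sy)// ltr_pwDr// le_max lexx.
Qed.

Lemma IB_oc x y : 0 < x ->
  mu.-integrable `]x, y] (fun s => (s `^ (- n - 1) * h s)%:E).
Proof.
move=> x0; apply: integrableS (IB x0) => // s /=.
by rewrite !in_itv/= => /andP[->].
Qed.

Lemma IA_0c y : 0 < y ->
  mu.-integrable `]0, y] (fun s => (s `^ (- m - 1) * h s)%:E).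
Proof.
move=> y0; have y1 : 0 < y + 1 by rewrite addr_gt0.
apply: integrableS (IA y1) => // s /=; rewrite !in_itv/= => /andP[-> sy] /=.
by rewrite (le_lt_trans sy)// ltrDl.
Qed.

Lemma lower_partE x : 0 < x -> A x = \int[mu]_(s in `]0, x]) (s `^ (- m - 1) * h s).
Proof. by move=> x0; rewrite /A Rintegral_itv_bndo_bndc//; exact: IA. Qed.

Lemma lower_part_incr x y : 0 < x -> x <= y ->
  A y - A x = \int[mu]_(s in `]x, y]) (s `^ (- m - 1) * h s).
Proof.
move=> x0 xy; have y0 := lt_le_trans x0 xy.
rewrite !lower_partE// Rintegral_itvB ?bnd_simp ?(ltW x0)//.
exact: IA_0c.
Qed.

Lemma upper_part_incr x y : 0 < x -> x <= y ->
  B x - B y = \int[mu]_(s in `]x, y]) (s `^ (- n - 1) * h s).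
Proof.
move=> x0 xy; rewrite /B -(@Rintegral_itvB _ _ (BRight x) +oo%O y) ?bnd_simp//.
  by rewrite opprB addrC subrK.
exact: IB.
Qed.

Lemma Rintegral_dominated (w : R -> R) (p q M : R) :
  mu.-integrable `]p, q] (fun s => (w s)%:E) ->
  mu.-integrable `]p, q] (fun s => (w s * h s)%:E) ->
  (forall s, p < s <= q -> 0 <= w s) ->
  (forall s, p < s <= q -> `|h s| <= M) ->
  `|\int[mu]_(s in `]p, q]) (w s * h s)| <= M * \int[mu]_(s in `]p, q]) w s.
Proof.
move=> iw iwh w0 hM.
apply: (le_trans (le_normr_Rintegral _ _)) => //.
rewrite -RintegralZl//; apply: le_Rintegral => //.
- by apply: (integrable_norm iwh).
- exact: (integrableZl _ M iw).
- move=> s /=; rewrite in_itv/= => ps.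
  by rewrite normrM ger0_norm ?w0// mulrC ler_wpM2r ?w0// hM.
Qed.

Lemma increasing_bound x y s : 0 < x -> x <= s <= y ->
  `|h s| <= `|h x| + `|h y|.
Proof.
move=> x0 /andP[xs sy]; have s0 := lt_le_trans x0 xs.
have h1 := h_incr x0 xs; have h2 := h_incr s0 sy.
have := ler_norm (h y); have := ler_norm (- h x); rewrite normrN.
have := normr_ge0 (h x); have := normr_ge0 (h y).
by rewrite ler_norml => *; apply/andP; split; lra.
Qed.

Lemma powR_expR_ln (k y s : R) : 0 < y -> 0 < s ->
  y `^ k * s `^ (- k) = expR (k * (ln y - ln s)).
Proof.
by move=> y0 s0; rewrite /powR !gt_eqF// -expRD; congr expR; ring.
Qed.

Lemma Rintegral_powR_oc (k p q : R) : k != 0 -> 0 < p -> p <= q ->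
  \int[mu]_(s in `]p, q]) (s `^ (k - 1)) = (q `^ k - p `^ k) / k.
Proof. by move=> k0 p0 pq; rewrite /Rintegral integral_powR_oc. Qed.

Lemma integrable_powR_oc (k p q : R) : 0 < p ->
  mu.-integrable `]p, q] (fun s => (s `^ k)%:E).
Proof.
move=> p0; apply: (@integrableS _ _ _ mu `[p, q]) => //; first exact: subset_itv_oc_cc.
apply: continuous_compact_integrable; first exact: segment_compact.
apply: continuous_in_subspaceT => s; rewrite inE/= in_itv/= => /andP[ps _].
by apply: powR_continuous; exact: lt_le_trans ps.
Qed.

(** With the integrals frozen at z, y ^ m A z + y ^ n B z is differentiable in y
    and its derivative at z is [raw_resolvent1 z]. The remainder below is the
    integral between z and y of h against a kernel of constant sign, so it is
    dominated by the same integral for h = 1, which is [frozen_gauge] and is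
    stationary at z. This yields the derivative of the resolvent at jumps of h as
    well, where A and B are not differentiable separately. *)
Definition frozen_remainder (z y : R) : R :=
  y `^ m * (A y - A z) + y `^ n * (B y - B z).

(** [frozen_remainder] for the payoff h = 1. *)
Definition frozen_gauge (z y : R) : R :=
  (1 - y `^ m * z `^ (- m)) / (- m) + (1 - y `^ n * z `^ (- n)) / n.

Lemma frozen_kernel_integral (z y p q : R) : 0 < y -> 0 < p -> p <= q ->
  \int[mu]_(s in `]p, q]) (y `^ n * s `^ (- n - 1) - y `^ m * s `^ (- m - 1)) =
  y `^ n * ((q `^ (- n) - p `^ (- n)) / - n) -
  y `^ m * ((q `^ (- m) - p `^ (- m)) / - m).
Proof.
move=> y0 p0 pq.
have i1 := integrable_powR_oc (- n - 1) q p0.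
have i2 := integrable_powR_oc (- m - 1) q p0.
rewrite RintegralB//; last 2 first.
- exact: (integrableZl _ (y `^ n) i1).
- exact: (integrableZl _ (y `^ m) i2).
by rewrite !RintegralZl// !Rintegral_powR_oc// ?(gt_eqF Nm0)// (lt_eqF Nn0).
Qed.

Lemma frozen_remainder_bound (z y : R) : 0 < z -> z / 2 < y < 2 * z ->
  `|frozen_remainder z y| <= (`|h (z / 2)| + `|h (2 * z)|) * `|frozen_gauge z y|.
Proof.
move=> z0 /andP[zy yz]; set M := (_ + _).
have z2 : 0 < z / 2 by rewrite divr_gt0.
have y0 : 0 < y by lra.
have M0 : 0 <= M by rewrite addr_ge0.
have hM s : z / 2 <= s <= 2 * z -> `|h s| <= M by exact: increasing_bound.
(* the kernel w has the sign of ln y - ln s *)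
pose w s := y `^ n * s `^ (- n - 1) - y `^ m * s `^ (- m - 1).
have iw p q : 0 < p -> mu.-integrable `]p, q] (fun s => (w s)%:E).
  move=> p0; have i1 := integrable_powR_oc (- n - 1) q p0.
  have i2 := integrable_powR_oc (- m - 1) q p0.
  have := integrableB _ (integrableZl _ (y `^ n) i1) (integrableZl _ (y `^ m) i2).
  exact.
have iwh p q : 0 < p -> mu.-integrable `]p, q] (fun s => (w s * h s)%:E).
  move=> p0; have := integrableB _ (integrableZl _ (y `^ n) (IB_oc q p0))
    (integrableZl _ (y `^ m) (IA_oc q p0)) => /(_ _ _ _)/= H.
  by apply: eq_integrable (H _ _ _) => // s _; rewrite /w -!EFinM -EFinB; congr EFin; ring.
have Iwh p q : 0 < p -> \int[mu]_(s in `]p, q]) (w s * h s) =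
    y `^ n * \int[mu]_(s in `]p, q]) (s `^ (- n - 1) * h s) -
    y `^ m * \int[mu]_(s in `]p, q]) (s `^ (- m - 1) * h s).
  move=> p0; have i1 := IB_oc q p0; have i2 := IA_oc q p0.
  rewrite -!RintegralZl// -RintegralB//; last 2 first.
  - exact: (integrableZl _ (y `^ n) i1).
  - exact: (integrableZl _ (y `^ m) i2).
  by apply: eq_Rintegral => s _; rewrite /w; ring.
have wE s : 0 < s -> w s = s^-1 * (expR (n * (ln y - ln s)) - expR (m * (ln y - ln s))).
  by move=> s0; rewrite /w -!powR_expR_ln// !powR_subr1//; ring.
have yK k : y `^ k * y `^ (- k) = 1 by rewrite powR_expR_ln// subrr mulr0 expR0.
have [zy'|yz'] := leP z y.
  have -> : frozen_remainder z y = - \int[mu]_(s in `]z, y]) (w s * h s).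
    rewrite Iwh// /frozen_remainder lower_part_incr//.
    rewrite -(opprB (B z)) upper_part_incr//.
    by move: (\int[_]_(_ in _) _) (\int[_]_(_ in _) _) => I1 I2; ring.
  have -> : frozen_gauge z y = - \int[mu]_(s in `]z, y]) w s.
    rewrite frozen_kernel_integral// !mulrA !mulrBr !yK /frozen_gauge.
    by field; rewrite lt_eqF// gt_eqF.
  rewrite !normrN; apply: (le_trans (Rintegral_dominated (iw _ _ z0) (iwh _ _ z0) _ _)).
  - move=> s /andP[zs sy]; have s0 : 0 < s by lra.
    have lsy : ln s <= ln y by rewrite ler_ln.
    rewrite wE// mulr_ge0 ?invr_ge0 ?(ltW s0)// subr_ge0 ler_expR.
    by apply: ler_wpM2r; [rewrite subr_ge0|exact: (ltW (lt_trans m0 n0))].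
  - by move=> s /andP[zs sy]; apply: hM; apply/andP; split; lra.
  by rewrite ler_wpM2l// ler_norm.
have -> : frozen_remainder z y = \int[mu]_(s in `]y, z]) (w s * h s).
  rewrite Iwh// /frozen_remainder upper_part_incr ?(ltW yz')//.
  rewrite -(opprB (A z)) lower_part_incr ?(ltW yz')//.
  by move: (\int[_]_(_ in _) _) (\int[_]_(_ in _) _) => I1 I2; ring.
have -> : frozen_gauge z y = \int[mu]_(s in `]y, z]) w s.
  rewrite frozen_kernel_integral ?(ltW yz')// !mulrA !mulrBr !yK /frozen_gauge.
  by field; rewrite lt_eqF// gt_eqF.
have iNw : mu.-integrable `]y, z] (fun s => (- w s)%:E).
  have := integrableZl _ (-1) (iw y z y0) => /(_ (measurable_itv _)).
  by apply: eq_integrable => // s _; rewrite -EFinM mulN1r.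
have iNwh : mu.-integrable `]y, z] (fun s => (- w s * h s)%:E).
  have := integrableZl _ (-1) (iwh y z y0) => /(_ (measurable_itv _)).
  by apply: eq_integrable => // s _; rewrite -EFinM mulN1r mulNr.
have NI : forall f, mu.-integrable `]y, z] (fun s => (f s)%:E) ->
  \int[mu]_(s in `]y, z]) (- f s) = - \int[mu]_(s in `]y, z]) f s.
  move=> f fi; under eq_Rintegral do rewrite -mulN1r.
  by rewrite RintegralZl// mulN1r.
rewrite -normrN -NI//; last exact: iwh.
rewrite -[X in _ <= M * X]normrN -NI//; last exact: iw.
under eq_Rintegral do rewrite -mulNr.
apply: (le_trans (Rintegral_dominated iNw iNwh _ _)).
- move=> s /andP[ys sz]; have s0 : 0 < s by lra.
  have lsy : ln y <= ln s by rewrite ler_ln// ?posrE// ltW.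
  rewrite oppr_ge0 wE// mulr_ge0_le0 ?invr_ge0 ?(ltW s0)// subr_le0 ler_expR.
  by apply: ler_wnM2r; [rewrite subr_le0|exact: (ltW (lt_trans m0 n0))].
- by move=> s /andP[zs sy]; apply: hM; apply/andP; split; lra.
by rewrite ler_wpM2l// ler_norm.
Qed.

Lemma frozen_gauge_derive (z : R) : 0 < z -> is_derive z 1 (frozen_gauge z) 0.
Proof.
move=> z0.
have dm := is_derive1_powR m z0; have dn := is_derive1_powR n z0.
have -> : frozen_gauge z = cst ((- m)^-1 + n^-1) +
    ((z `^ (- m) / m) \*: (fun y : R => y `^ m) -
     (z `^ (- n) / n) \*: (fun y : R => y `^ n)).
  apply/funext => y; change (frozen_gauge z y = (- m)^-1 + n^-1 +
    (z `^ (- m) / m * y `^ m - z `^ (- n) / n * y `^ n)).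
  rewrite /frozen_gauge; field.
  by rewrite (gt_eqF n0) (lt_eqF m0).
have z1 k : z `^ (- k) * z `^ (k - 1) = z^-1.
  by rewrite powR_subr1// mulrA [z `^ (- k) * _]mulrC powR_expR_ln// subrr mulr0 expR0 mul1r.
have dd := is_deriveD (is_derive_cst ((- m)^-1 + n^-1) z 1)
  (is_deriveB (is_deriveZ (z `^ (- m) / m) dm) (is_deriveZ (z `^ (- n) / n) dn)).
apply: (is_derive_eq dd); rewrite add0r.
change (z `^ (- m) / m * (m * z `^ (m - 1)) - z `^ (- n) / n * (n * z `^ (n - 1)) = 0).
have -> : z `^ (- m) / m * (m * z `^ (m - 1)) = z `^ (- m) * z `^ (m - 1).
  by field; rewrite lt_eqF.
have -> : z `^ (- n) / n * (n * z `^ (n - 1)) = z `^ (- n) * z `^ (n - 1).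
  by field; rewrite gt_eqF.
by rewrite !z1 subrr.
Qed.

Lemma frozen_remainder_derive (z : R) : 0 < z -> is_derive z 1 (frozen_remainder z) 0.
Proof.
move=> z0; have dg := frozen_gauge_derive z0.
apply: (@is_derive_dominated0 _ _ _ _ (`|h (z / 2)| + `|h (2 * z)|) dg).
- by rewrite /frozen_gauge !powR_expR_ln// subrr !mulr0 expR0 subrr !mul0r addr0.
- by rewrite /frozen_remainder !subrr !mulr0 addr0.
near=> y; apply: frozen_remainder_bound => //; apply/andP; split.
- near: y; apply: lt_nbhsr; rewrite ltr_pdivrMr// mulr_natr mulr2n; lra.
- near: y; apply: lt_nbhsl; lra.
Unshelve. all: by end_near.
Qed.

(** The resolvent without its normalizing constant. *)
Definition raw_resolvent (x : R) : R := x `^ m * A x + x `^ n * B x.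

(** The derivatives of A and B do not appear: their contributions cancel. *)
Definition raw_resolvent1 (x : R) : R :=
  m * x `^ (m - 1) * A x + n * x `^ (n - 1) * B x.

Lemma raw_resolvent_derive (z : R) : 0 < z ->
  is_derive z 1 raw_resolvent (raw_resolvent1 z).
Proof.
move=> z0.
have dm := is_derive1_powR m z0; have dn := is_derive1_powR n z0.
have dr := frozen_remainder_derive z0.
have -> : raw_resolvent = (A z \*: (fun y : R => y `^ m) +
    B z \*: (fun y : R => y `^ n)) + frozen_remainder z.
  apply/funext => y; change (raw_resolvent y =
    A z * y `^ m + B z * y `^ n + frozen_remainder z y).
  by rewrite /raw_resolvent /frozen_remainder; ring.
have dd := is_deriveD (is_deriveD (is_deriveZ (A z) dm) (is_deriveZ (B z) dn)) dr.
apply: (is_derive_eq dd); rewrite addr0.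
change (A z * (m * z `^ (m - 1)) + B z * (n * z `^ (n - 1)) = raw_resolvent1 z).
by rewrite /raw_resolvent1; ring.
Qed.

Lemma part_incr_bound (w : R -> R) (k p q z : R) : 0 < z -> k != 0 ->
  z / 2 <= p -> p <= q -> q <= 2 * z ->
  (forall x y, 0 < x -> mu.-integrable `]x, y] (fun s => (s `^ (k - 1) * h s)%:E)) ->
  `|\int[mu]_(s in `]p, q]) (s `^ (k - 1) * h s)| <=
  (`|h (z / 2)| + `|h (2 * z)|) * ((q `^ k - p `^ k) / k).
Proof.
move=> z0 k0 zp pq qz I.
have z2 : 0 < z / 2 by rewrite divr_gt0.
have p0 : 0 < p by exact: lt_le_trans zp.
rewrite -Rintegral_powR_oc//.
apply: Rintegral_dominated => //.
- exact: integrable_powR_oc.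
- exact: I.
- by move=> s _; exact: powR_ge0.
move=> s /andP[ps sq]; apply: increasing_bound => //.
by rewrite (le_trans zp (ltW ps)) (le_trans sq).
Qed.

(** Increments of A and B are increments of a power times a local bound of h. *)
Lemma continuous_of_powR_bound (f : R -> R) (k M z : R) : 0 < z ->
  (forall p q, z / 2 <= p -> p <= q -> q <= 2 * z ->
    `|f q - f p| <= M * ((q `^ k - p `^ k) / k)) ->
  {for z, continuous f}.
Proof.
move=> z0 fM; pose L := `|M * k^-1| + 1.
have L0 : 0 < L by rewrite ltr_wpDl.
have fL p q : z / 2 <= p -> p <= q -> q <= 2 * z ->
    `|f q - f p| <= L * `|q `^ k - p `^ k|.
  move=> zp pq qz; apply: (le_trans (fM _ _ zp pq qz)).
  rewrite mulrCA mulrC; apply: (le_trans (ler_norm _)).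
  by rewrite normrM ler_wpM2r// lerDl.
apply/cvgrPdist_le => e e0.
have /cvgrPdist_le/(_ (e / L))/(_ (divr_gt0 e0 L0)) ck := powR_continuous (k := k) z0.
near=> y.
have zy : z / 2 <= y.
  by apply/ltW; near: y; apply: lt_nbhsr; rewrite ltr_pdivrMr//; lra.
have yz : y <= 2 * z by apply/ltW; near: y; apply: lt_nbhsl; lra.
have zz : z / 2 <= z by rewrite ler_pdivrMr//; lra.
have z2 : z <= 2 * z by lra.
have : `|z `^ k - y `^ k| <= e / L by near: y.
rewrite ler_pdivlMr// mulrC; apply: le_trans.
by have [h1|/ltW h1] := leP y z; [|rewrite distrC [X in _ * X]distrC]; exact: fL.
Unshelve. all: by end_near.
Qed.

Lemma lower_part_continuous (z : R) : 0 < z -> {for z, continuous A}.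
Proof.
move=> z0; have k0 : - m != 0 by rewrite gt_eqF.
apply: (@continuous_of_powR_bound _ (- m) (`|h (z / 2)| + `|h (2 * z)|)) => // p q zp pq qz.
have p0 : 0 < p by apply: lt_le_trans zp; rewrite divr_gt0.
rewrite lower_part_incr//; apply: part_incr_bound => // x y x0.
exact: IA_oc.
Qed.

Lemma upper_part_continuous (z : R) : 0 < z -> {for z, continuous B}.
Proof.
move=> z0; have k0 : - n != 0 by rewrite lt_eqF.
apply: (@continuous_of_powR_bound _ (- n) (`|h (z / 2)| + `|h (2 * z)|)) => // p q zp pq qz.
have p0 : 0 < p by apply: lt_le_trans zp; rewrite divr_gt0.
rewrite distrC upper_part_incr//; apply: part_incr_bound => // x y x0.
exact: IB_oc.
Qed.

Lemma raw_resolvent1_continuous (z : R) : 0 < z -> {for z, continuous raw_resolvent1}.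
Proof.
move=> z0; apply: cvgD; apply: cvgM.
- by apply: cvgM; [exact: cvg_cst|exact: powR_continuous].
- exact: lower_part_continuous.
- by apply: cvgM; [exact: cvg_cst|exact: powR_continuous].
- exact: upper_part_continuous.
Qed.

Lemma lower_part_derive (z : R) : 0 < z -> {for z, continuous h} ->
  is_derive z 1 A (z `^ (- m - 1) * h z).
Proof.
move=> z0 ch.
have cf : {for z, continuous (fun s => s `^ (- m - 1) * h s)}.
  by apply: cvgM; [exact: powR_continuous|exact: ch].
have z1 : 0 < z + 1 by rewrite addr_gt0.
have zz1 : z < z + 1 by rewrite ltrDl.
have b0 : (BRight 0 < BRight z)%O by rewrite bnd_simp.
have [dF DF] := continuous_FTC1 zz1 (IA_0c z1) b0 cf.
rewrite derive1E in DF.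
apply: (@near_eq_is_derive _ _ _ _ _ _ _ _ _ (DeriveDef dF DF)).
by near=> y; rewrite lower_partE//; near: y; exact: lt_nbhsr.
Unshelve. all: by end_near.
Qed.

Lemma upper_part_derive (z : R) : 0 < z -> {for z, continuous h} ->
  is_derive z 1 B (- (z `^ (- n - 1) * h z)).
Proof.
move=> z0 ch.
have cf : {for z, continuous (fun s => s `^ (- n - 1) * h s)}.
  by apply: cvgM; [exact: powR_continuous|exact: ch].
have z2 : 0 < z / 2 by rewrite divr_gt0.
have zz : z / 2 < z by rewrite ltr_pdivrMr//; lra.
have zz1 : z < z + 1 by rewrite ltrDl.
have b0 : (BRight (z / 2) < BRight z)%O by rewrite bnd_simp.
have [dF DF] := continuous_FTC1 zz1 (IB_oc _ z2) b0 cf.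
rewrite derive1E in DF.
have dd := is_deriveB (is_derive_cst (B (z / 2)) z 1) (DeriveDef dF DF).
rewrite sub0r in dd.
apply: (@near_eq_is_derive _ _ _ _ _ _ _ _ _ dd).
near=> y.
have zy : z / 2 < y by near: y; exact: lt_nbhsr.
by rewrite /= !fctE -(upper_part_incr z2 (ltW zy)) opprB addrC subrK.
Unshelve. all: by end_near.
Qed.

(** In the second derivative the contributions of the derivatives of A and B no
    longer cancel but add up to (m - n) h, which is why it jumps with h. *)
Definition raw_resolvent2 (x : R) : R :=
  (m * (m - 1) * x `^ m * A x + n * (n - 1) * x `^ n * B x + (m - n) * h x) / x ^+ 2.

Lemma raw_resolvent1_derive (z : R) : 0 < z -> {for z, continuous h} ->
  is_derive z 1 raw_resolvent1 (raw_resolvent2 z).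
Proof.
move=> z0 ch.
have dA := lower_part_derive z0 ch; have dB := upper_part_derive z0 ch.
have dm := is_derive1_powR (m - 1) z0; have dn := is_derive1_powR (n - 1) z0.
have dd := is_deriveD (is_deriveM (is_deriveZ m dm) dA) (is_deriveM (is_deriveZ n dn) dB).
apply: (is_derive_eq dd).
change (m * z `^ (m - 1) * (z `^ (- m - 1) * h z) + A z * (m * ((m - 1) * z `^ (m - 1 - 1))) +
  (n * z `^ (n - 1) * (- (z `^ (- n - 1) * h z)) + B z * (n * ((n - 1) * z `^ (n - 1 - 1)))) =
  raw_resolvent2 z).
have E k : z `^ (- k) = (z `^ k)^-1 by rewrite powRN.
rewrite !powR_subr1// !E /raw_resolvent2; field.
by rewrite !powR_neq0// gt_eqF.
Qed.

Lemma raw_resolvent1E (x : R) : 0 < x ->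
  raw_resolvent1 x = (m * x `^ m * A x + n * x `^ n * B x) / x.
Proof. by move=> x0; rewrite /raw_resolvent1 !powR_subr1//; ring. Qed.

Lemma raw_resolvent2_continuous (z : R) : 0 < z -> {for z, continuous h} ->
  {for z, continuous raw_resolvent2}.
Proof.
move=> z0 ch; apply: cvgM.
  apply: cvgD; last by apply: cvgM; [exact: cvg_cst|exact: ch].
  apply: cvgD; apply: cvgM.
  - by apply: cvgM; [exact: cvg_cst|exact: powR_continuous].
  - exact: lower_part_continuous.
  - by apply: cvgM; [exact: cvg_cst|exact: powR_continuous].
  - exact: upper_part_continuous.
apply: cvgV; first by rewrite expf_neq0// gt_eqF.
exact: exprn_continuous.
Qed.

Lemma lower_part_le (x : R) : 0 < x -> A x <= h x * (x `^ (- m) / - m).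
Proof.
move=> x0.
have -> : x `^ (- m) / - m = \int[mu]_(s in `]0, x]) (s `^ (- m - 1)).
  by rewrite /Rintegral integral_powR_0.
rewrite lower_partE// -RintegralZl//; last exact: integrable_powR_0.
apply: le_Rintegral => //.
- exact: IA_0c.
- exact: (integrableZl _ (h x) (integrable_powR_0 Nm0 x0)).
move=> s /=; rewrite in_itv/= => /andP[s0 sx].
by rewrite mulrC ler_wpM2r ?powR_ge0// h_incr.
Qed.

Lemma upper_part_ge (x : R) : 0 < x -> h x * (x `^ (- n) / n) <= B x.
Proof.
move=> x0.
have -> : x `^ (- n) / n = \int[mu]_(s in `]x, +oo[) (s `^ (- n - 1)).
  by rewrite /Rintegral integral_powR_y//= mulNr invrN mulrN opprK.
rewrite -RintegralZl//; last exact: integrable_powR_y.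
apply: le_Rintegral => //.
- exact: (integrableZl _ (h x) (integrable_powR_y Nn0 x0)).
- exact: IB.
move=> s /=; rewrite in_itv/= andbT => xs.
by rewrite mulrC ler_wpM2l ?powR_ge0// h_incr// ltW.
Qed.

(** As h is nondecreasing, replacing it by the constant h x increases A x and
    decreases B x, hence decreases this derivative, which is 0 for a constant
    payoff. *)
Lemma raw_resolvent1_ge0 (x : R) : 0 < x -> 0 <= raw_resolvent1 x.
Proof.
move=> x0; rewrite raw_resolvent1E// divr_ge0// ?(ltW x0)//.
have xm : x `^ m * x `^ (- m) = 1 by rewrite powR_expR_ln// subrr mulr0 expR0.
have xn : x `^ n * x `^ (- n) = 1 by rewrite powR_expR_ln// subrr mulr0 expR0.
have hA : - h x <= m * x `^ m * A x.
  have := lower_part_le x0; rewrite -(@ler_nM2l _ (m * x `^ m)); last first.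
    by rewrite nmulr_rlt0// powR_gt0.
  apply: le_trans; rewrite le_eqVlt; apply/orP; left; apply/eqP.
  rewrite (_ : m * x `^ m * (h x * (x `^ (- m) / - m)) = - (h x * (x `^ m * x `^ (- m)))).
    by rewrite xm mulr1.
  by field; rewrite lt_eqF.
have hB : h x <= n * x `^ n * B x.
  have := upper_part_ge x0; rewrite -(@ler_pM2l _ (n * x `^ n)); last first.
    by rewrite mulr_gt0// powR_gt0.
  apply: le_trans; rewrite le_eqVlt; apply/orP; left; apply/eqP.
  rewrite (_ : n * x `^ n * (h x * (x `^ (- n) / n)) = h x * (x `^ n * x `^ (- n))).
    by rewrite xn mulr1.
  by field; rewrite gt_eqF.
lra.
Qed.

Lemma raw_resolvent_nondecreasing (x y : R) : 0 < x -> x <= y ->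
  raw_resolvent x <= raw_resolvent y.
Proof.
move=> x0; rewrite le_eqVlt => /predU1P[->//|xy].
have pos s : s \in `[x, y] -> 0 < s by rewrite in_itv/= => /andP[+ _]; exact: lt_le_trans.
have := @ger0_derive1_le_cc _ raw_resolvent x y _ _ _ x y.
apply; rewrite ?in_itv/= ?lexx ?ltW//.
- move=> s; rewrite in_itv/= => /andP[xs _].
  by have [] := raw_resolvent_derive (lt_trans x0 xs).
- move=> s; rewrite in_itv/= => /andP[xs _].
  have [_] := raw_resolvent_derive (lt_trans x0 xs).
  by rewrite derive1E => ->; rewrite raw_resolvent1_ge0// (lt_trans x0 xs).
- apply: continuous_in_subspaceT => s; rewrite inE => /pos s0.
  apply/differentiable_continuous/derivable1_diffP.
  by have [] := raw_resolvent_derive s0.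
Qed.

End ResolventCalculus.

(** * Monotone payoffs near 0 and their jumps *)

Section MonotoneFunction.
Context {R : realType}.
Variable h : R -> R.
Hypotheses (h_incr : increasing_pos h).

(** The limit at 0 of a nondecreasing function is its infimum. *)
Lemma h_zero_geP (M : R) : (M%:E <= h_zero h)%E <-> forall x, 0 < x -> M <= h x.
Proof.
have nd : {in Interval (BRight (0 : R)) +oo%O &, nondecreasing_fun (EFin \o h)}.
  move=> x y; rewrite !in_itv/= !andbT => x0 _ xy; rewrite lee_fin.
  exact: h_incr.
have -> : h_zero h = ereal_inf ((EFin \o h) @` `]0, +oo[).
  by apply/cvg_lim => //; apply: nondecreasing_at_right_cvge nd.
split=> [Mh x x0|Mh].
  rewrite -lee_fin; apply: (le_trans Mh); apply: ereal_inf_lbound.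
  by exists x => //=; rewrite in_itv/= x0.
apply: le_ereal_inf_tmp => _ /= [x + <-]; rewrite in_itv/= andbT => x0.
by rewrite lee_fin Mh.
Qed.

Hypothesis h_rc : right_continuous_pos h.

Lemma jumps_discontinuity (x : R) : jumps h x -> discontinuity h x.
Proof.
move=> [x0 ncx].
have cr : h y @[y --> x^'+] --> h x by exact: h_rc.
have cl : cvg (h y @[y --> x^'-]).
  apply: nondecreasing_at_left_is_cvgr.
    near=> s; move=> u v; rewrite !in_itv/= => /andP[su _] _ uv.
    apply: h_incr => //; apply: lt_trans su; near: s; exact: nbhs_left_gt.
  near=> s; exists (h x) => _ /= [u + <-]; rewrite in_itv/= => /andP[su ux].
  apply: h_incr; last exact: ltW.
  apply: lt_trans su; near: s; exact: nbhs_left_gt.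
split => //; first by apply/cvg_ex; exists (h x).
apply/eqP => E; apply: ncx.
apply/left_right_continuousP; split => //.
by rewrite -(cvg_lim (@Rhausdorff R) cr) -E.
Unshelve. all: by end_near.
Qed.

(** A monotone function has countably many discontinuities, and an interval of
    positive length is not countable. *)
Lemma regular_point (E : set R) (dl : R) : finite_set E -> 0 < dl ->
  exists x, [/\ 0 < x, x < dl & ~ (E `|` jumps h) x].
Proof.
move=> fE dl0; apply: contrapT => H.
have d20 : 0 < dl / 2 by rewrite divr_gt0.
have sub : `]dl / 2, dl[%classic `<=`
    E `|` [set x | x \in (`]dl / 2, dl[) /\ discontinuity h x].
  move=> x /=; rewrite in_itv/= => /andP[dx xd].
  have x0 : 0 < x by exact: lt_trans dx.
  have [//|nE] := pselect (E x); first by left.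
  right; split; first by rewrite dx.
  apply: jumps_discontinuity; apply: contrapT => nj.
  by apply: H; exists x; split => // -[].
have cnt : countable `]dl / 2, dl[%classic.
  apply: sub_countable (subset_card_le sub) _.
  rewrite -bigcup2E; apply: bigcup_countable => // -[|[|i]] _ /=.
  - exact: finite_set_countable.
  - apply: discontinuity_countable => u v; rewrite !in_itv/= => /andP[du _] _ uv.
    by apply: h_incr => //; exact: lt_le_trans d20 du.
  - exact: countable0.
have := countable_lebesgue_measure0 cnt.
have /= -> := lebesgue_measure_itv `]dl / 2, dl[.
rewrite lte_fin ltr_pdivrMr// ltr_pMr// ltr1n -EFinD => -[]; lra.
Qed.

End MonotoneFunction.

(** * The resolvent and the variational inequalities *)

Section Exponents.
Context {R : realType}.
Variables (b sigma r : R).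
Hypotheses (sigma0 : sigma != 0) (r0 : 0 < r).
Notation m := (exponent_m b sigma r).
Notation n := (exponent_n b sigma r).

Let s2 : 0 < sigma ^+ 2.
Proof. by rewrite lt0r sqr_ge0 expf_neq0. Qed.

Let denominator_gt0 : 0 < 2 * sigma ^+ 2.
Proof. by rewrite pmulr_rgt0. Qed.

Let delta := (b - sigma ^+ 2) ^+ 2 + 4 * sigma ^+ 2 * r.

Let delta_ge0 : 0 <= delta.
Proof. by rewrite addr_ge0 ?sqr_ge0// mulr_ge0 ?(ltW r0)// mulr_ge0// ltW. Qed.

Let sqr_root : Num.sqrt delta ^+ 2 = delta.
Proof. by rewrite sqr_sqrtr. Qed.

Let lt_root : `|b - sigma ^+ 2| < Num.sqrt delta.
Proof.
rewrite -sqrtr_sqr ltr_sqrt; first by rewrite ltrDl mulr_gt0// mulr_gt0.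
by rewrite ltr_wpDl ?sqr_ge0// mulr_gt0// mulr_gt0.
Qed.

Lemma exponent_m_lt0 : m < 0.
Proof.
rewrite /exponent_m -/delta ltr_pdivrMr// mul0r.
by have := ler_norm (- (b - sigma ^+ 2)); rewrite normrN; have := lt_root; lra.
Qed.

Lemma exponent_n_gt0 : 0 < n.
Proof.
rewrite /exponent_n -/delta divr_gt0//.
by have := ler_norm (b - sigma ^+ 2); have := lt_root; lra.
Qed.

Lemma exponent_m_root : sigma ^+ 2 * (m * (m - 1)) + b * m = r.
Proof.
apply/eqP; rewrite -subr_eq0; apply/eqP.
have -> : sigma ^+ 2 * (m * (m - 1)) + b * m - r =
    (Num.sqrt delta ^+ 2 - delta) / (4 * sigma ^+ 2).
  by rewrite /exponent_m -/delta /delta; field.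
by rewrite sqr_root subrr mul0r.
Qed.

Lemma exponent_n_root : sigma ^+ 2 * (n * (n - 1)) + b * n = r.
Proof.
apply/eqP; rewrite -subr_eq0; apply/eqP.
have -> : sigma ^+ 2 * (n * (n - 1)) + b * n - r =
    (Num.sqrt delta ^+ 2 - delta) / (4 * sigma ^+ 2).
  by rewrite /exponent_n -/delta /delta; field.
by rewrite sqr_root subrr mul0r.
Qed.

Lemma exponent_mul : sigma ^+ 2 * (m * n) = - r.
Proof.
apply/eqP; rewrite -subr_eq0; apply/eqP.
have -> : sigma ^+ 2 * (m * n) - - r =
    (delta - Num.sqrt delta ^+ 2) / (4 * sigma ^+ 2).
  by rewrite /exponent_m /exponent_n -/delta /delta; field.
by rewrite sqr_root subrr mul0r.
Qed.

End Exponents.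

Section ResolventODE.
Context {R : realType}.
Notation mu := (@lebesgue_measure R).
Variables (b sigma r : R) (h : R -> R).
Hypotheses (sigma0 : sigma != 0) (r0 : 0 < r) (h_incr : increasing_pos h).
Notation m := (exponent_m b sigma r).
Notation n := (exponent_n b sigma r).
Hypothesis IA : forall x, 0 < x ->
  mu.-integrable `]0, x[ (fun s => (s `^ (- m - 1) * h s)%:E).
Hypothesis IB : forall x, 0 < x ->
  mu.-integrable `]x, +oo[ (fun s => (s `^ (- n - 1) * h s)%:E).
Notation A := (lower_part m h).
Notation B := (upper_part n h).
Notation k := (sigma ^+ 2 * (n - m))^-1.

Let m0 : m < 0. Proof. exact: exponent_m_lt0. Qed.
Let n0 : 0 < n. Proof. exact: exponent_n_gt0. Qed.

Let kd0 : 0 < sigma ^+ 2 * (n - m).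
Proof.
have s2 : 0 < sigma ^+ 2 by rewrite lt0r sqr_ge0 expf_neq0.
by rewrite pmulr_rgt0// subr_gt0 (lt_trans m0).
Qed.

Let k0 : 0 < k. Proof. by rewrite invr_gt0. Qed.

Lemma resolventE (x : R) : resolvent b sigma r h x = k * raw_resolvent m n h x.
Proof. by []. Qed.

Lemma resolvent_nondecreasing (x y : R) : 0 < x -> x <= y ->
  resolvent b sigma r h x <= resolvent b sigma r h y.
Proof.
move=> x0 xy; rewrite !resolventE ler_wpM2l ?(ltW k0)//.
exact: raw_resolvent_nondecreasing.
Qed.

(** Both w1 and w0 are the resolvent plus a constant e. *)
Lemma shifted_resolvent_derive (e x : R) : 0 < x ->
  is_derive x 1 (fun y => resolvent b sigma r h y + e) (k * raw_resolvent1 m n h x).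
Proof.
move=> x0; have dr := raw_resolvent_derive m0 n0 h_incr IA IB x0.
have dd := is_deriveD (is_deriveZ k dr) (is_derive_cst e x 1).
by rewrite addr0 in dd.
Qed.

Lemma derive1_shifted_resolvent (e x : R) : 0 < x ->
  derive1 (fun y => resolvent b sigma r h y + e) x = k * raw_resolvent1 m n h x.
Proof. by move=> /(shifted_resolvent_derive e)[_]; rewrite derive1E. Qed.

Lemma near_derive1_shifted_resolvent (e x : R) : 0 < x ->
  \forall y \near x, k * raw_resolvent1 m n h y =
    derive1 (fun y => resolvent b sigma r h y + e) y.
Proof.
move=> x0; near=> y; rewrite derive1_shifted_resolvent//; near: y.
exact: lt_nbhsr.
Unshelve. all: by end_near.
Qed.

Lemma shifted_resolvent_C1 (e : R) : C1_pos (fun y => resolvent b sigma r h y + e).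
Proof.
move=> x x0; split; first by have [] := shifted_resolvent_derive e x0.
have c : {for x, continuous (fun y => k * raw_resolvent1 m n h y)}.
  by apply: cvgM; [exact: cvg_cst|exact: raw_resolvent1_continuous].
have E := near_derive1_shifted_resolvent e x0.
rewrite /prop_for /continuous_at -(nbhs_singleton E).
by apply: cvg_trans c; apply: near_eq_cvg.
Qed.

Lemma derive1_shifted_resolvent_derive (e x : R) : 0 < x -> {for x, continuous h} ->
  is_derive x 1 (derive1 (fun y => resolvent b sigma r h y + e))
    (k * raw_resolvent2 m n h x).
Proof.
move=> x0 cx; apply: near_eq_is_derive (near_derive1_shifted_resolvent e x0) _.
exact: (is_deriveZ k (raw_resolvent1_derive IA IB x0 cx)).
Qed.

(** Off the jumps of h the second derivative is a combination of continuous
    functions and of h itself. *)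
Lemma shifted_resolvent_C2 (e : R) (E : set R) :
  C2_pos_outside (E `|` jumps h) (fun y => resolvent b sigma r h y + e).
Proof.
have reg x : 0 < x -> ~ (E `|` jumps h) x -> {for x, continuous h}.
  by move=> x0 Nx; apply: contrapT => cx; apply: Nx; right.
split=> [x x0 /(reg _ x0) cx|].
  by have [] := derive1_shifted_resolvent_derive e x0 cx.
apply/subspace_continuousP => x [/= x0 Nx].
have cx := reg _ x0 Nx.
have d2 y : 0 < y -> {for y, continuous h} ->
    derive1 (derive1 (fun y => resolvent b sigma r h y + e)) y = k * raw_resolvent2 m n h y.
  move=> y0 cy; have [_] := derive1_shifted_resolvent_derive e y0 cy.
  by rewrite derive1E.
have c : {for x, continuous (fun y => k * raw_resolvent2 m n h y)}.
  by apply: cvgM; [exact: cvg_cst|exact: raw_resolvent2_continuous].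
have cw : k * raw_resolvent2 m n h y
      @[y --> within ([set x | 0 < x] `\` (E `|` jumps h)) (nbhs x)] -->
    k * raw_resolvent2 m n h x by exact: cvg_within_filter c.
rewrite /from_subspace d2//; apply: cvg_trans cw.
apply: near_eq_cvg; near=> y.
have [/= y0 Ny] : ([set x | 0 < x] `\` (E `|` jumps h)) y by near: y; exact: withinT.
by rewrite d2//; exact: reg.
Unshelve. all: by end_near.
Qed.

(** The terms in A and B carry the characteristic polynomial of m and n as a
    factor, and the normalization turns (m - n) h into - h. *)
Lemma resolvent_ode (e x : R) : 0 < x -> {for x, continuous h} ->
  let w := fun y => resolvent b sigma r h y + e in
  sigma ^+ 2 * x ^+ 2 * derive1 (derive1 w) x + b * x * derive1 w x - r * w x =
  - h x - r * e.
Proof.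
move=> x0 cx w.
have -> : derive1 (derive1 w) x = k * raw_resolvent2 m n h x.
  by have [_] := derive1_shifted_resolvent_derive e x0 cx; rewrite derive1E.
rewrite derive1_shifted_resolvent// /w resolventE raw_resolvent1E//.
rewrite /raw_resolvent2 /raw_resolvent.
have Em := exponent_m_root b sigma0 r0; have En := exponent_n_root b sigma0 r0.
have x1 : x != 0 by rewrite gt_eqF.
have nm1 : n - m != 0 by rewrite subr_eq0 gt_eqF// (lt_trans m0).
have -> : sigma ^+ 2 * x ^+ 2 * (k * ((m * (m - 1) * x `^ m * A x +
      n * (n - 1) * x `^ n * B x + (m - n) * h x) / x ^+ 2)) +
    b * x * (k * ((m * x `^ m * A x + n * x `^ n * B x) / x)) -
    r * (k * (x `^ m * A x + x `^ n * B x) + e) =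
    k * ((sigma ^+ 2 * (m * (m - 1)) + b * m - r) * (x `^ m * A x) +
         (sigma ^+ 2 * (n * (n - 1)) + b * n - r) * (x `^ n * B x)) - h x - r * e.
  by field; rewrite x1 sigma0 nm1.
by rewrite Em En; ring.
Qed.

(** The resolvent of the constant payoff M is M / r. *)
Lemma resolvent_weight (M : R) : k * (M / - m + M / n) = M / r.
Proof.
rewrite -[in RHS](opprK r) -(exponent_mul b sigma0 r0); field.
by rewrite sigma0 (gt_eqF n0) (lt_eqF m0) subr_eq0 (gt_eqF (lt_trans m0 n0)).
Qed.

Let powR_cancel (c x : R) : 0 < x -> x `^ c * x `^ (- c) = 1.
Proof. by move=> x0; rewrite powR_expR_ln// subrr mulr0 expR0. Qed.

Lemma lower_part_ge (M x : R) : 0 < x -> (forall y, 0 < y -> M <= h y) ->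
  M * (x `^ (- m) / - m) <= A x.
Proof.
move=> x0 Mh; have Nm0 : 0 < - m by rewrite oppr_gt0.
have -> : x `^ (- m) / - m = \int[mu]_(s in `]0, x]) (s `^ (- m - 1)).
  by rewrite /Rintegral integral_powR_0.
rewrite (lower_partE IA x0) -RintegralZl//; last exact: integrable_powR_0.
apply: le_Rintegral => //.
- exact: (integrableZl _ M (integrable_powR_0 Nm0 x0)).
- exact: (IA_0c IA x0).
move=> s /=; rewrite in_itv/= => /andP[s0 _].
by rewrite mulrC ler_wpM2l ?powR_ge0// Mh.
Qed.

(** Comparison with the constant payoff M. *)
Lemma resolvent_ge (M x : R) : 0 < x -> (forall y, 0 < y -> M <= h y) ->
  M / r <= resolvent b sigma r h x.
Proof.
move=> x0 Mh; rewrite resolventE -resolvent_weight ler_wpM2l ?(ltW k0)//.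
apply: lerD.
  apply: (@le_trans _ _ (x `^ m * (M * (x `^ (- m) / - m)))); last first.
    by rewrite ler_wpM2l ?powR_ge0// lower_part_ge.
  by rewrite mulrCA [x `^ m * (_ / _)]mulrA powR_cancel// mul1r.
apply: (@le_trans _ _ (x `^ n * (h x * (x `^ (- n) / n)))); last first.
  by rewrite ler_wpM2l ?powR_ge0//; exact: (upper_part_ge n0 h_incr IB).
rewrite mulrCA [x `^ n * (_ / _)]mulrA powR_cancel// mul1r.
by rewrite ler_wpM2r ?invr_ge0 ?(ltW n0)// Mh.
Qed.

(** Replacing h by its largest value h x1 on ]0, x1] gives the resolvent of a
    constant payoff; what lies beyond x1 enters through a multiple of x ^ n. *)
Lemma resolvent_le_near0 (x1 : R) : 0 < x1 -> exists C, forall x, 0 < x -> x <= x1 ->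
  resolvent b sigma r h x <= h x1 / r + C * x `^ n.
Proof.
move=> x10; pose L := h x1.
exists (k * (B x1 - L * (x1 `^ (- n) / n))) => x x0 xx1.
rewrite -resolvent_weight -/L.
have Bx : B x <= B x1 + L * ((x `^ (- n) - x1 `^ (- n)) / n).
  rewrite -lerBlDl (upper_part_incr IB x0 xx1).
  have -> : (x `^ (- n) - x1 `^ (- n)) / n = \int[mu]_(s in `]x, x1]) (s `^ (- n - 1)).
    rewrite Rintegral_powR_oc ?oppr_eq0 ?(gt_eqF n0)//.
    by rewrite invrN mulrN -mulNr opprB.
  have i := integrable_powR_oc (- n - 1) x1 x0.
  rewrite -RintegralZl//; apply: le_Rintegral => //.
  - exact: (IB_oc IB).
  - exact: (integrableZl _ L i).
  move=> s /=; rewrite in_itv/= => /andP[xs sx1].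
  by rewrite mulrC ler_wpM2r ?powR_ge0// h_incr// (lt_trans x0).
have Ax : A x <= L * (x `^ (- m) / - m).
  apply: le_trans (lower_part_le m0 h_incr IA x0) _.
  rewrite ler_wpM2r ?h_incr// divr_ge0 ?powR_ge0// oppr_ge0; exact: ltW.
have -> : k * (L / - m + L / n) + k * (B x1 - L * (x1 `^ (- n) / n)) * x `^ n =
   k * (x `^ m * (L * (x `^ (- m) / - m)) +
        x `^ n * (B x1 + L * ((x `^ (- n) - x1 `^ (- n)) / n))).
  rewrite -mulrA -mulrDr; congr (k * _).
  rewrite [X in X + _ = _](_ : _ = x `^ m * x `^ (- m) * (L / - m) +
     x `^ n * x `^ (- n) * (L / n)); last by rewrite !powR_cancel// !mul1r.
  by ring.
by rewrite resolventE ler_wpM2l ?(ltW k0)//; apply: lerD; rewrite ler_wpM2l ?powR_ge0.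
Qed.

(** The converse of [resolvent_ge]: by [resolvent_le_near0] the limit of the
    resolvent at 0 is at most h x1 / r. *)
Lemma payoff_ge (M x1 : R) : (forall x, 0 < x -> M / r <= resolvent b sigma r h x) ->
  0 < x1 -> M <= h x1.
Proof.
move=> MR x10; rewrite leNgt; apply/negP => hM.
have [C RC] := resolvent_le_near0 x10.
(* near 0 the term C * x `^ n is too small to bridge this gap *)
have gap : 0 < (M - h x1) / r by rewrite divr_gt0// subr_gt0.
have Cx0 : C * x `^ n @[x --> 0^'+] --> C * 0.
  by apply: cvgM; [exact: cvg_cst|exact: powR_cvg0].
rewrite mulr0 in Cx0.
near (0 : R)^'+ => x.
have x0 : 0 < x by near: x; exact: nbhs_right_gt.
have xx1 : x <= x1 by near: x; exact: nbhs_right_le.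
have Cx : C * x `^ n < (M - h x1) / r.
  near: x; exact: (cvgr_lt _ Cx0 _ gap).
have := le_trans (MR _ x0) (RC _ x0 xx1).
by rewrite mulrBl in Cx; lra.
Unshelve. all: by end_near.
Qed.

(** At a continuity point the first entry of the equation for w1 vanishes, and
    the second is negative. In the equation for w0 the middle entry vanishes and
    the other two ask for r K1 <= h x and K1 - K <= w1 x; the latter implies
    the remaining condition - K <= w1 x of the first equation. Since h and w1 are
    nondecreasing, the two conditions hold on all of (0, oo) as soon as they
    hold at regular points near 0, and the one on w1 then amounts to
    r (K1 - K) <= h by [resolvent_ge] and [payoff_ge]. *)
Lemma resolvent_solves_HJB_iff (K1 K0 K : R) : 0 < K1 -> 0 < K0 ->
    right_continuous_pos h ->
  solves_HJB b sigma r K1 K0 K h (resolvent b sigma r h)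
    (fun x => resolvent b sigma r h x - K1) <->
  ((Num.max (r * K1) (r * K1 - r * K))%:E <= h_zero h)%E.
Proof.
move=> K10 K00 h_rc.
have w1E : resolvent b sigma r h = (fun y => resolvent b sigma r h y + 0).
  by apply/funext => y; rewrite addr0.
have reg (E : set R) x : 0 < x -> ~ (E `|` jumps h) x -> {for x, continuous h}.
  by move=> x0 Nx; apply: contrapT => cx; apply: Nx; right.
rewrite (h_zero_geP h_incr); split=> [[_ [_ [E [fE [_ [_ HJB]]]]]]|Mh].
  have small x : 0 < x -> exists2 y, 0 < y <= x &
      r * K1 <= h y /\ K1 - K <= resolvent b sigma r h y.
    move=> x0; have [y [y0 yx Ny]] := regular_point h_incr h_rc fE x0.
    exists y; first by rewrite y0 ltW.
    have [_] := HJB y y0 Ny; rewrite resolvent_ode//; last exact: (reg E).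
    move=> maxE; split.
      have := lexx (0 : R); rewrite -{1}maxE ge_max => /andP[+ _]; lra.
    have := lexx (0 : R); rewrite -{1}maxE !ge_max => /and3P[_ _]; lra.
  move=> x x0; rewrite ge_max; apply/andP; split.
    have [y /andP[y0 yx] [hy _]] := small x x0.
    exact: le_trans hy (h_incr y0 yx).
  apply: payoff_ge x0 => z z0; have [y /andP[y0 yz] [_ Ry]] := small z z0.
  rewrite -mulrBr mulrAC mulfV ?gt_eqF// mul1r.
  exact: le_trans Ry (resolvent_nondecreasing y0 yz).
have C1 : C1_pos (resolvent b sigma r h) by rewrite w1E; exact: shifted_resolvent_C1.
split; first exact: C1.
split; first exact: shifted_resolvent_C1.
exists set0; split; first exact: finite_set0.
split; first by rewrite w1E; exact: shifted_resolvent_C2.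
split; first exact: shifted_resolvent_C2.
move=> x x0 Nx; have cx := reg _ x x0 Nx.
have RK : K1 - K <= resolvent b sigma r h x.
  have -> : K1 - K = (r * K1 - r * K) / r by field; rewrite gt_eqF.
  apply: resolvent_ge => // y y0; have := Mh y y0; rewrite ge_max => /andP[_]; exact.
have hK : r * K1 <= h x by have := Mh x x0; rewrite ge_max => /andP[].
split.
  have := resolvent_ode 0 x0 cx; rewrite /= -w1E mulr0 subr0 addr0 => ->.
  by rewrite addrC subrr; apply/max_idPl; rewrite ge_max; apply/andP; split; lra.
rewrite resolvent_ode//; apply/eqP; rewrite eq_le; apply/andP; split.
  by rewrite !ge_max; apply/and3P; split; lra.
by rewrite !le_max; apply/orP; right; apply/orP; left; lra.
Qed.

End ResolventODE.

Theorem lemma1 (R : realType) (d : measure_display) (T : measurableType d)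
    (P : probability T R) (F : R -> set (set T)) (W : R -> T -> R)
    (b sigma r K1 K0 K : R) (h : R -> R)
    (hF : is_filtration F) (hW : is_brownian_motion P F W)
    (hsigma : sigma != 0) (hr : 0 < r) (hK1 : 0 < K1) (hK0 : 0 < K0)
    (h_rc : right_continuous_pos h) (h_incr : increasing_pos h)
    (h_infty : h x @[x --> +oo] --> +oo)
    (h_int : forall x : R, 0 < x -> forall X : R -> T -> R,
       solves_sde P F W b sigma x X ->
       (expected_discounted_abs P r h X < +oo)%E) :
  let w1 := fun x : R => resolvent b sigma r h x in
  let w0 := fun x : R => resolvent b sigma r h x - K1 in
  increasing_pos w1 /\ increasing_pos w0 /\
  (solves_HJB b sigma r K1 K0 K h w1 w0 <->
   ((Num.max (r * K1) (r * K1 - r * K))%:E <= h_zero h)%E).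
Proof.
move=> w1 w0.
have occ := occupation_minorant_integral_lty hF hW hsigma hr h_incr
  (h_int 1 ltr01 _ (gbm_solves_sde b sigma hF hW ltr01)).
have IA := integrable_power_m hsigma h_incr occ.
have IB := integrable_power_n hsigma h_incr occ.
have incr := resolvent_nondecreasing hsigma hr h_incr IA IB.
split; first exact: incr.
split.
- by move=> x y x0 xy; rewrite lerB// incr.
- exact: resolvent_solves_HJB_iff.
Qed.
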